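(* Let $N\ge1$, $d\ge 1$, and $f\in\mathcal L_N$. Then for any $\mathbf p=(\mathbf p_1,\dots,\mathbf p_N)\in(\mathbb R^d)^N$, $$V_{f,1}(\mathbf p)=\frac1{\kappa_{d-1}}\int_{\mathbb S^{d-1}}f\big(\langle\mathbf u,\mathbf p_1\rangle,\dots,\langle\mathbf u,\mathbf p_N\rangle\big)\,\mathrm d\mathbf u,$$ where $f$ is evaluated on real numbers by interpreting $a\cup b=\max\{a,b\}$ and $a\cap b=\min\{a,b\}$.
   Context: $\kappa_n$ is the volume of the unit ball of $\mathbb R^n$ ($\kappa_0=1$); $\mathrm d\mathbf u$ is the surface measure on the unit sphere $\mathbb S^{d-1}$ (counting measure if $d=1$). Boolean algebra. $\mathcal B_N$ is the free Boolean algebra generated by $x_1,\dots,x_N$, with operations $\cup,\cap$, complement $f\mapsto\bar f$, greatest element $X$, least element $\emptyset$; $f\setminus g=f\cap\bar g$. Put $[N]=\{1,\dots,N\}$. $\mathcal L_N$ is the sublattice of $\mathcal B_N$ generated by $x_1,\dots,x_N$ under $\cup$ and $\cap$; $\mathcal C_N\supset\mathcal L_N$ is the set of elements that can be built from $x_1,\dots,x_N$ using only $\cup,\cap,\setminus$. For $\emptyset\ne I\subseteq[N]$ let $u_I=\bigcup_{i\in I}x_i$. $\mathcal M_N$ is the space of functions $\mu:\mathcal C_N\to\mathbb R$ with $\mu(f\cup g)=\mu(f)+\mu(g)$ whenever $f\cap g=\emptyset$. For each $f\in\mathcal C_N$, the integers $m_{f,I}$ ($\emptyset\neq I\subseteq[N]$)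 are the unique ones such that $\mu(f)=\sum_{\emptyset\ne I\subseteq[N]}m_{f,I}\,\mu(u_I)$ for all $\mu\in\mathcal M_N$. Boolean intrinsic volumes. For a nonempty compact convex $K\subset\mathbb R^d$, the intrinsic volumes $V_k(K)$ are defined by Steiner's formula $\mathrm{vol}_d(K+B^d(\mathbf 0,r))=\sum_{k=0}^d\kappa_{d-k}V_k(K)r^{d-k}$, $r\ge0$, where $B^d(\mathbf 0,r)$ is the closed ball of radius $r$ about the origin. $K_I(\mathbf p)$ is the convex hull of $\{\mathbf p_i:i\in I\}$, and for $f\in\mathcal C_N$, $V_{f,k}(\mathbf p)=\sum_{\emptyset\ne I\subseteq[N]}m_{f,I}V_k(K_I(\mathbf p))$. *)

(* Defs.v *)
From HB Require Import structures.
From mathcomp Require Import all_boot all_order all_algebra.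
From mathcomp Require Import all_classical all_reals all_analysis.

Set Implicit Arguments.
Unset Strict Implicit.
Unset Printing Implicit Defensive.

Import Order.Theory GRing.Theory Num.Theory.
Import numFieldNormedType.Exports.

Local Open Scope classical_set_scope.
Local Open Scope ring_scope.

(* The free Boolean algebra on N generators, realized as the algebra of truth
   tables: an element is the set of the truth assignments that satisfy it, an
   assignment being given by the set S of the generators that are true.  The
   universal property is [free_booleanP]. *)
Notation free_boolean N := {set {set 'I_N}}.

Definition generator N (i : 'I_N) : free_boolean N :=
  [set S : {set 'I_N} | i \in S]%SET.

Section FreeBoolean.
Variables (disp : Order.disp_t) (B : ctbDistrLatticeType disp) (N : nat).

Definition boolean_morphism (phi : free_boolean N -> B) : Prop :=
  [/\ phi finset.set0 = \bot%O, phi finset.setT = \top%O,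
      forall f g, phi (f :|: g)%SET = (phi f `|` phi g)%O,
      forall f g, phi (f :&: g)%SET = (phi f `&` phi g)%O &
      forall f, phi (~: f)%SET = (~` (phi f))%O].

Let minterm (y : 'I_N -> B) (S : {set 'I_N}) : B :=
  (\meet_(i : 'I_N) (if i \in S then y i else ~` (y i)))%O.

Let bmorph y (f : free_boolean N) : B := (\join_(S in f) minterm y S)%O.

Let meet_bigjoin I (r : seq I) (P : pred I) (F : I -> B) (b : B) :
  (b `&` \join_(i <- r | P i) F i = \join_(i <- r | P i) (b `&` F i))%O.
Proof. exact: (big_morph (Order.meet b) (meetUr b) (meetx0 b)). Qed.

Let minterm_disj y (S T : {set 'I_N}) :
  S != T -> (minterm y S `&` minterm y T = \bot)%O.
Proof.
move=> /eqP ST.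
have [i iST] : exists i, (i \in S) != (i \in T).
  apply/existsP; apply: contra_notT ST; rewrite negb_exists => /forallP h.
  by apply/setP => i; have := h i; rewrite negbK => /eqP.
apply/eqP; rewrite -lex0.
have hS := @meets_inf _ _ _ i predT (fun i => if i \in S then y i else ~` (y i))%O isT.
have hT := @meets_inf _ _ _ i predT (fun i => if i \in T then y i else ~` (y i))%O isT.
apply: le_trans (leI2 hS hT) _.
by case: (i \in S) (i \in T) iST => [] [] //= _; rewrite ?meetxC ?meetCx lexx.
Qed.

Let minterm_cover y : (\join_(S : {set 'I_N}) minterm y S = \top)%O.
Proof.
suff H (s : seq 'I_N) : (\join_(S : {set 'I_N})
    \meet_(i <- s) (if i \in S then y i else ~` (y i)) = \top)%O by exact: H.
elim: s => [|i s IH].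
  under eq_bigr do rewrite big_nil.
  by apply/eqP; rewrite -le1x; apply: (@joins_sup _ _ _ finset.set0 predT (fun=> \top%O)).
have [is_|is_] := boolP (i \in s).
  rewrite -[RHS]IH; apply: eq_bigr => S _; rewrite big_cons; apply/meet_idPr.
  exact: meets_inf_seq.
apply/eqP; rewrite -le1x.
have e b : (b = \join_(S : {set 'I_N})
    (b `&` \meet_(j <- s) (if j \in S then y j else ~` (y j))))%O.
  by rewrite -meet_bigjoin IH meetx1.
rewrite -[X in (X <= _)%O](joinxC (y i)) [X in (X `|` _ <= _)%O]e.
rewrite [X in (_ `|` X <= _)%O]e.
rewrite leUx; apply/andP; split; apply/joinsP=> S _.
- have -> : (y i `&` \meet_(i0 <- s) (if i0 \in S then y i0 else ~` y i0) =
    \meet_(i0 <- i :: s) (if i0 \in (i |: S)%SET then y i0 else ~` y i0))%O.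
    rewrite big_cons setU11; congr (_ `&` _)%O; apply: eq_big_seq => j js.
    rewrite in_setU1; case: eqP => // ji; by rewrite -ji js in is_.
  exact: (@joins_sup _ _ _ (i |: S)%SET predT
    (fun S : {set 'I_N} => \meet_(j <- i :: s) (if j \in S then y j else ~` y j))%O).
- have -> : (~` y i `&` \meet_(i0 <- s) (if i0 \in S then y i0 else ~` y i0) =
    \meet_(i0 <- i :: s) (if i0 \in (S :\ i)%SET then y i0 else ~` y i0))%O.
    rewrite big_cons setD11; congr (_ `&` _)%O; apply: eq_big_seq => j js.
    rewrite in_setD1; case: eqP => // ji; by rewrite -ji js in is_.
  exact: (@joins_sup _ _ _ (S :\ i)%SET predT
    (fun S : {set 'I_N} => \meet_(j <- i :: s) (if j \in S then y j else ~` y j))%O).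
Qed.

Theorem free_booleanP (y : 'I_N -> B) :
  exists! phi : free_boolean N -> B,
    boolean_morphism phi /\ forall i, phi (generator i) = y i.
Proof.
have b0 : bmorph y finset.set0 = \bot%O by rewrite /bmorph big_set0.
have bT : bmorph y finset.setT = \top%O.
  by rewrite -(minterm_cover y); apply: eq_bigl => S; rewrite inE.
have bU f g : bmorph y (f :|: g)%SET = (bmorph y f `|` bmorph y g)%O.
  exact: joins_setU.
have bI f g : bmorph y (f :&: g)%SET = (bmorph y f `&` bmorph y g)%O.
  apply/eqP; rewrite eq_le lexI; apply/andP; split; first apply/andP; first split.
  - by apply/joinsP=> S; rewrite inE => /andP[Sf _]; apply: joins_sup.
  - by apply/joinsP=> S; rewrite inE => /andP[_ Sf]; apply: joins_sup.
  - rewrite {1}/bmorph meetC meet_bigjoin; apply/joinsP=> S Sf.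
    rewrite {1}/bmorph meetC meet_bigjoin; apply/joinsP=> T Tg.
    have [ST|/(minterm_disj y) ->] := eqVneq S T; last exact: le0x.
    by rewrite -ST meetxx; apply: joins_sup; rewrite inE Sf ST.
have bC f : bmorph y (~: f)%SET = (~` (bmorph y f))%O.
  have dis : (bmorph y (~: f)%SET `&` bmorph y f = \bot)%O.
    by rewrite -bI finset.setIC finset.setICr.
  have cov : (bmorph y f `|` bmorph y (~: f)%SET = \top)%O.
    by rewrite -bU finset.setUCr.
  apply/eqP; rewrite eq_le -disj_leC dis eqxx /=.
  by rewrite -[X in (X <= _)%O]meetx1 -cov meetUr meetCx join0x leIr.
have bg i : bmorph y (generator i) = y i.
  have h1 : (bmorph y (generator i) <= y i)%O.
    apply/joinsP=> S; rewrite inE => iS.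
    have := @meets_inf _ _ _ i predT (fun i => if i \in S then y i else ~` (y i))%O isT.
    by rewrite iS.
  have h2 : (bmorph y (~: generator i)%SET <= ~` (y i))%O.
    apply/joinsP=> S; rewrite !inE => /negbTE iS.
    have := @meets_inf _ _ _ i predT (fun i => if i \in S then y i else ~` (y i))%O isT.
    by rewrite iS.
  by apply/eqP; rewrite eq_le h1 -leC -bC.
exists (bmorph y); split=> // phi [[p0 pT pU pI pC] pg].
have pm S : phi [set S]%SET = minterm y S.
  have -> : [set S]%SET = (\bigcap_(i : 'I_N)
      (if i \in S then generator i else ~: generator i))%SET.
    apply/setP => T; rewrite inE; apply/eqP/bigcapP => [-> i _|h].
      by case: ifPn => iS; rewrite !inE.
    by apply/setP => i; move: (h i isT); case: ifPn => _; rewrite !inE // => /negbTE.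
  rewrite (big_morph phi pI pT); apply: eq_bigr => i _.
  by case: ifP; rewrite ?pC pg.
apply/funext => f; rewrite /bmorph; under eq_bigr do rewrite -pm.
rewrite -(big_morph phi pU p0); congr phi; apply/setP => S.
by apply/bigcupP/idP => [[T Tf /set1P->]//|Sf]; exists S; rewrite ?inE.
Qed.
End FreeBoolean.

Inductive lattice_expr (N : nat) : Type :=
| LVar of 'I_N
| LCup of lattice_expr N & lattice_expr N
| LCap of lattice_expr N & lattice_expr N.

(* The element of the lattice L_N denoted by an expression. *)
Fixpoint lattice_elt N (t : lattice_expr N) : free_boolean N :=
  match t with
  | LVar i => generator i
  | LCup s t => (lattice_elt s :|: lattice_elt t)%SET
  | LCap s t => (lattice_elt s :&: lattice_elt t)%SET
  end.

Fixpoint lattice_eval (R : realType) N (t : lattice_expr N) (a : 'I_N -> R) : R :=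
  match t with
  | LVar i => a i
  | LCup s t => Num.max (lattice_eval s a) (lattice_eval t a)
  | LCap s t => Num.min (lattice_eval s a) (lattice_eval t a)
  end.

(* The class C_N. *)
Inductive difference_class (N : nat) : free_boolean N -> Prop :=
| DGen i : difference_class (generator i)
| DCup f g : difference_class f -> difference_class g ->
    difference_class (f :|: g)%SET
| DCap f g : difference_class f -> difference_class g ->
    difference_class (f :&: g)%SET
| DDiff f g : difference_class f -> difference_class g ->
    difference_class (f :\: g)%SET.

Definition gen_union N (I : {set 'I_N}) : free_boolean N :=
  (\bigcup_(i in I) generator i)%SET.

(* The space M_N; the values of mu outside C_N are irrelevant. *)
Definition additive_on_class (R : realType) N (mu : free_boolean N -> R) : Prop :=
  forall f g, difference_class f -> difference_class g ->
    (f :&: g)%SET = finset.set0 -> mu (f :|: g)%SET = mu f + mu g.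

Definition is_union_coefs (R : realType) N (f : free_boolean N)
    (m : {ffun {set 'I_N} -> int}) : Prop :=
  m finset.set0 = 0 /\
  forall mu : free_boolean N -> R, additive_on_class mu ->
    mu f = \sum_(I : {set 'I_N} | I != finset.set0)
             (m I)%:~R * mu (gen_union I).

(* The integers m_{f,I}; the one at I = set0 is set to 0. *)
Definition union_coef (R : realType) N (f : free_boolean N) :
    {ffun {set 'I_N} -> int} :=
  xget [ffun=> 0] [set m | is_union_coefs R f m].

Section Euclidean.
Variable R : realType.

Definition dotp d (u v : 'rV[R]_d) : R := \sum_(i < d) u 0 i * v 0 i.

(* The norm provided by the library on 'rV[R]_d is the sup norm. *)
Definition enorm d (u : 'rV[R]_d) : R := Num.sqrt (dotp u u).

Definition eball d (r : R) : set 'rV[R]_d := [set v | enorm v <= r].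

Definition esphere d : set 'rV[R]_d := [set u | enorm u = 1].

(* d-dimensional Lebesgue measure, as the d-fold iterated product of
   [lebesgue_measure]: integrate the measures of the sections along the first
   coordinate (cf. [product_measure1]); R^0 carries the unit point mass. *)
Fixpoint volume d : set 'rV[R]_d -> \bar R :=
  match d with
  | 0%N => fun A => (\1_A (0 : 'rV[R]_0))%:E
  | d'.+1 => fun A =>
      \int[@lebesgue_measure R]_x
        volume [set v : 'rV[R]_d' | A (row_mx (x%:M : 'rV[R]_1) v)]
  end%E.

Definition ball_volume n : R := fine (volume (@eball n 1)).

(* R^d with the Borel sigma-algebra. *)
Definition borel_space d := g_sigma_algebraType (@open 'rV[R]_d).

(* The surface measure on the unit sphere (a measure on R^d carried by the
   sphere), via the volume of the cone over A:
   sigma(A) = d * vol_d {r u : u in A, 0 < r <= 1}.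
   For d = 1 it is the counting measure on {-1, 1}. *)
Definition surface_measure d (A : set (borel_space d)) : \bar R :=
  (d%:R%:E * volume [set v : 'rV[R]_d | exists r u,
     [/\ 0 < r <= 1, A u, esphere u & v = r *: u]%R])%E.

Definition minkowski_sum d (A B : set 'rV[R]_d) : set 'rV[R]_d :=
  [set a + b | a in A & b in B].

Definition is_intrinsic_volumes d (K : set 'rV[R]_d) (V : nat -> R) : Prop :=
  (forall k, (d < k)%N -> V k = 0) /\
  forall r : R, 0 <= r ->
    volume (minkowski_sum K (eball r)) =
      (\sum_(k < d.+1) ball_volume (d - k) * V k * r ^+ (d - k))%:E.

(* V_k(K), by Steiner's formula; meaningful for K nonempty, compact, convex. *)
Definition intrinsic_volume d (k : nat) (K : set 'rV[R]_d) : R :=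
  xget (fun=> 0) [set V : nat -> R | is_intrinsic_volumes K V] k.

Definition hull d N (I : {set 'I_N}) (p : 'I_N -> 'rV[R]_d) : set 'rV[R]_d :=
  [set x | exists2 w : 'I_N -> R,
     (forall i, 0 <= w i) /\ \sum_(i in I) w i = 1 &
     x = \sum_(i in I) w i *: p i].

Definition boolean_intrinsic_volume d N (f : free_boolean N) (k : nat)
    (p : 'I_N -> 'rV[R]_d) : R :=
  \sum_(I : {set 'I_N} | I != finset.set0)
    (union_coef R f I)%:~R * intrinsic_volume k (hull I p).

End Euclidean.

Lemma volume0 (R : realType) d : volume (set0 : set 'rV[R]_d) = 0%E.
Proof.
elim: d => [|d IH] /=; first by rewrite indic0.
by under eq_integral do rewrite (_ : [set _ | _] = set0) // IH; rewrite integral0.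
Qed.

Lemma volume_box (R : realType) d (a b : 'I_d -> R) : (forall i, a i <= b i) ->
  volume [set v : 'rV[R]_d | forall i, a i <= v 0 i <= b i] =
  (\prod_(i < d) (b i - a i))%:E.
Proof.
elim: d a b => [|d IH] a b ab /=.
  by rewrite big_ord0 indicE mem_set//= => -[].
set P := \prod_(i < d) (b (lift ord0 i) - a (lift ord0 i)).
have sec x : volume [set v : 'rV[R]_d | forall i : 'I_d.+1,
      a i <= (row_mx (x%:M : 'rV[R]_1) v : 'rV[R]_(1 + d)) 0 i <= b i] =
    (P%:E * (\1_(`[a ord0, b ord0]%classic) x)%:E)%E.
  have rE (v : 'rV[R]_d) : (forall i : 'I_d.+1,
        a i <= (row_mx (x%:M : 'rV[R]_1) v : 'rV[R]_(1 + d)) 0 i <= b i) <->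
      a ord0 <= x <= b ord0 /\
      forall i, a (lift ord0 i) <= v 0 i <= b (lift ord0 i).
    have r0 : (row_mx (x%:M : 'rV[R]_1) v : 'rV[R]_(1 + d)) 0 ord0 = x.
      by rewrite [ord0](_ : _ = lshift d (ord0 : 'I_1)) ?row_mxEl ?mxE//; exact: val_inj.
    have rS i : (row_mx (x%:M : 'rV[R]_1) v : 'rV[R]_(1 + d)) 0 (lift ord0 i) = v 0 i.
      by rewrite [lift _ i](_ : _ = rshift 1 i) ?row_mxEr//; exact: val_inj.
    split => [h|[h0 h] i].
      by split=> [|i]; [have := h ord0; rewrite r0|have := h (lift ord0 i); rewrite rS].
    by have [j ->|->] := unliftP ord0 i; rewrite ?rS ?r0.
  rewrite indicE /=; have [xab|xab] := boolP (x \in `[a ord0, b ord0]).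
    rewrite mem_set// mule1 -IH//; congr volume; apply/seteqP; split=> v /=.
      by move/rE => -[].
    by move=> h; apply/rE; split=> //; rewrite in_itv in xab.
  rewrite memNset; last exact/negP.
  rewrite mule0 -(volume0 R d); congr volume; apply/seteqP; split=> v //=.
  by move/rE => -[h _]; move: xab; rewrite in_itv/= h.
under eq_integral do rewrite sec.
have P0 : 0 <= P by apply: prodr_ge0 => i _; rewrite subr_ge0.
under eq_integral do rewrite -EFinM.
have -> := @integralZl_indic _ _ R (@lebesgue_measure R) setT measurableT
  (fun=> `[a ord0, b ord0]%classic) P; [|by rewrite ltNge P0|by []].
rewrite integral_indic// setIT /= lebesgue_measure_itv/= lte_fin big_ord_recl.
have := ab ord0; rewrite le_eqVlt => /orP[/eqP <-|->].
  by rewrite ltxx mule0 subrr mul0r.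
by rewrite -EFinB -EFinM mulrC.
Qed.

(* Main.v *)
From HB Require Import structures.
Require Import Defs.
From mathcomp Require Import all_boot all_order all_algebra.
From mathcomp Require Import all_classical all_reals all_analysis.
From mathcomp Require Import measurable_realfun ring lra.
Set Implicit Arguments.
Unset Strict Implicit.
Unset Printing Implicit Defensive.
Import Order.Theory GRing.Theory Num.Theory.
Import numFieldNormedType.Exports.
Local Open Scope classical_set_scope.
Local Open Scope ring_scope.

(** Write h_J(u) for the maximum of <u, p_i> over i in J, which is the support
   function of the hull K_J of the points p_i, i in J.  The formula follows from
   two facts: V_1(K_J) is the integral of h_J over the sphere divided by
   kappa_{d-1} ([intrinsic_volume1_support]), and the lattice polynomial f
   evaluated at real numbers a is the sum over J of m_{f,J} max_J a
   ([lattice_evalE]).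

   The second fact only uses that the m_{f,J} represent f against the additive
   functions g |-> [S in g].  For S = {i | s < a_i} this says that the indicator
   of s < f(a) is the combination, with coefficients m_{f,J}, of the indicators
   of s < max_J a.  As s varies these indicators determine the numbers
   ([threshold_sum]).  That coefficients exist is Moebius inversion: every atom
   is an integer combination of unions of generators ([union_span_atom]).

   For the first fact Steiner's formula is needed in full, since V_1 is one of
   its coefficients.  Let K = K_I and let rho(x) be the point of K nearest to x.
   The parallel body K + rB is cut according to the set J of the vertices where
   x - rho(x) attains its maximum over K.  The piece of J is the sum of K_J and
   of the vectors z, of norm at most r, whose set of maximizing vertices is J
   ([pieceP]); these z are orthogonal to K_J, so that the linear map fixing the
   direction of K_J and multiplying the orthogonal vectors by r carries the piece
   of radius 1 onto that of radius r ([piece_scaling]).  Its volume is thus a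
   monomial in r, and K + rB has polynomial volume ([steiner_formula]).

   The effect of that linear map on the volume is found without determinants.
   The volume is, up to a factor, the only translation-invariant measure
   ([volume_unique]); hence a linear map scales it by a constant, this constant
   is multiplicative, therefore invariant under conjugation, and for a diagonal
   map it is read off from the image of a box ([volume_conj_diag]).

   It remains to find the coefficient of r^(d-1).  Far away in the direction u,
   the body K + rB ends at distance r + h(u) + O(1/r) ([minkowski_lower],
   [minkowski_upper]).  Slicing the sphere by the levels of h, with mesh delta,
   squeezes the volume of K + rB between sums of the polynomials
   (r + c)^d vol(cone of the slice), and comparing the two leading coefficients
   yields the integral of h up to O(delta) ([support_integral_bounds]). *)

(** * Borel sets and coordinates *)

Lemma open_borel (R : realType) d (U : set 'rV[R]_d) :
  open U -> measurable (U : set (borel_space R d)).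
Proof. by move=> oU; apply: sub_sigma_algebra. Qed.

Lemma measurable_borelP (R : realType) d disp (T : measurableType disp)
    (f : T -> 'rV[R]_d) :
  (forall U, open U -> measurable (f @^-1` U)) ->
  measurable_fun setT (f : T -> borel_space R d).
Proof.
move=> h; apply: (@measurability _ _ T (borel_space R d) setT f (@open 'rV[R]_d)) => //.
by move=> _ [U oU <-]; rewrite setTI; exact: h.
Qed.

(** An open set of R x R^d is a countable union of measurable rectangles: the
   first sides are the rational intervals, and the second side is the interior
   of the set of the v that are good for the whole interval. *)
Lemma measurable_row_mx (R : realType) d :
  measurable_fun setT
    (fun xv : measurableTypeR R * borel_space R d =>
       (row_mx (xv.1%:M : 'rV_1) xv.2 : 'rV[R]_d.+1) : borel_space R d.+1).
Proof.
apply: measurable_borelP => U oU.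
pose B (q : rat) (n : nat) : set R := ball (ratr q : R) n.+1%:R^-1.
pose G q n : set 'rV[R]_d := interior [set v | forall x, B q n x ->
   U (row_mx (x%:M : 'rV_1) v : 'rV[R]_d.+1)].
rewrite (_ : _ @^-1` _ = \bigcup_q \bigcup_n (B q n `*` G q n)).
  apply: bigcupT_measurable_rat => q; apply: bigcupT_measurable => n.
  apply: measurableX; first by apply: open_measurable; apply: ball_open; rewrite invr_gt0.
  exact: (@open_borel R d _ (open_interior _)).
apply/seteqP; split=> [[x v] /= Uxv|[x v] [q _ [n _ /= [Bx Gv]]]]; last first.
  by have /= := interior_subset Gv; exact.
have : nbhs (row_mx (x%:M : 'rV_1) v : 'rV[R]_d.+1) U by exact: open_nbhs_nbhs.
move=> /nbhs_ballP[e /= e0 eU].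
have [n ne] : exists n : nat, n.+1%:R^-1 < e / 2.
  have e20 : 0 < e / 2 by rewrite divr_gt0.
  by have [n _ /(_ n (leqnn n)) ?] := near_infty_natSinv_lt (PosNum e20); exists n.
have : x - n.+1%:R^-1 < x + n.+1%:R^-1.
  by rewrite ltrD2l gtrN ?invr_gt0.
move=> /rat_in_itvoo[q]; rewrite in_itv/= => /andP[q1 q2].
exists q => //; exists n => //; split; rewrite /B/=.
  by rewrite /ball/= ltr_distlC ltrBlDr q2 -ltrBlDr q1.
apply/nbhs_ballP; exists e => //= v' vv' y; rewrite /B /ball/= => qy.
apply: eU; split=> // i j; rewrite !mxE; case: vv' => _ /(_ i).
case: splitP => k _ vv'; last exact: vv'.
rewrite !mxE !ord1 eqxx !mulr1n /ball/=.
rewrite (le_lt_trans (ler_distD (ratr q) _ _))// [e]splitr.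
rewrite ltrD// (lt_trans _ ne)// distrC ltr_distlC.
by rewrite ltrBlDr q2 -ltrBlDr q1.
Qed.

Lemma continuous_borel (R : realType) d (f : 'rV[R]_d -> R) :
  continuous f -> measurable_fun setT (f : borel_space R d -> measurableTypeR R).
Proof.
move=> /continuousP cf; apply: (measurability _ (RGenOpens.measurableE R)).
move=> _ [_ [a [b ->] <-]]; rewrite setTI; apply: open_borel.
exact/cf/interval_open.
Qed.

Lemma measurable_coord (R : realType) d (i : 'I_d) :
  measurable_fun setT (fun v : borel_space R d => (v : 'rV[R]_d) 0 i).
Proof. by apply: continuous_borel; apply: coord_continuous. Qed.

Lemma row_mx0E (R : realType) d (v : 'rV[R]_d.+1) :
  v = (row_mx ((v 0 0)%:M : 'rV_1) (\row_i v 0 (lift ord0 i)) : 'rV[R]_d.+1).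
Proof.
apply/rowP => i; rewrite !mxE; case: splitP => j ij; rewrite !mxE.
  by rewrite !ord1 eqxx mulr1n; congr (v _ _); apply: val_inj; rewrite /= ij ord1.
by congr (v _ _); apply: val_inj; rewrite /= ij.
Qed.

Lemma measurable_coordP (R : realType) d disp (T : measurableType disp)
    (f : T -> 'rV[R]_d) :
  (forall i, measurable_fun setT (fun t => f t 0 i)) ->
  measurable_fun setT (f : T -> borel_space R d).
Proof.
elim: d f => [|d IH] f mf.
  apply: measurable_borelP => U _; have [U0|U0] := pselect (U 0).
    rewrite (_ : _ @^-1` _ = setT)//; apply/seteqP; split=> // t _ /=.
    by rewrite (_ : f t = 0)//; apply/rowP => -[].
  rewrite (_ : _ @^-1` _ = set0)//; apply/seteqP; split=> // t /=.
  by rewrite (_ : f t = 0)//; apply/rowP => -[].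
pose g t : measurableTypeR R * borel_space R d :=
  (f t 0 0, \row_i f t 0 (lift ord0 i)).
have mg : measurable_fun setT g.
  apply: measurable_fun_pair; first exact: mf.
  by apply: IH => i; under eq_fun do rewrite mxE; exact: mf.
rewrite (_ : f = (fun xv : measurableTypeR R * borel_space R d =>
       (row_mx (xv.1%:M : 'rV_1) xv.2 : 'rV[R]_d.+1)) \o g).
  exact: measurableT_comp (@measurable_row_mx R d) mg.
by apply/funext => t /=; rewrite {1}[f t]row_mx0E.
Qed.

(** * The volume as a measure *)

Section SigmaFinitePack.
Context {R : realType} disp (T : measurableType disp).
Variables (m : {measure set T -> \bar R}) (mfin : sigma_finite setT m).

(** A named copy of m, on which the structure of sigma-finite measure can be
   declared. *)
Definition pack_measure : set T -> \bar R := m.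

HB.instance Definition _ := Measure.on pack_measure.
HB.instance Definition _ :=
  Measure_isSigmaFinite.Build _ _ _ pack_measure mfin.

Lemma sigma_finite_measureP :
  exists m' : {sigma_finite_measure set T -> \bar R},
    (m' : set T -> \bar R) = m.
Proof. by exists pack_measure. Qed.

End SigmaFinitePack.

Section SigmaFinite.
Context {R : realType}.

Lemma pushforward_measureP d1 d2 (T1 : measurableType d1)
    (T2 : measurableType d2) (m : {measure set T1 -> \bar R}) (f : T1 -> T2) :
  measurable_fun setT f ->
  exists m' : {measure set T2 -> \bar R},
    (m' : set T2 -> \bar R) = pushforward m f.
Proof. by move=> mf; unshelve eexists (pushforward m f). Qed.

(** The preimages by g of the exhausting sets of T1 exhaust T2 and are pulled back
   by f to these sets. *)
Lemma sigma_finite_pushforward d1 d2 (T1 : measurableType d1)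
    (T2 : measurableType d2) (m : {sigma_finite_measure set T1 -> \bar R})
    (f : T1 -> T2) (g : T2 -> T1) :
  measurable_fun setT f -> measurable_fun setT g -> cancel f g ->
  exists m' : {sigma_finite_measure set T2 -> \bar R},
    (m' : set T2 -> \bar R) = pushforward m f.
Proof.
move=> mf mg fK.
have [mm mmE] := pushforward_measureP m mf.
rewrite -mmE; apply: sigma_finite_measureP; rewrite mmE.
have [F FT Foo] := sigma_finiteT m.
exists (fun n => g @^-1` F n).
  by rewrite -preimage_bigcup -FT preimage_setT.
move=> n; have [mF Fn] := Foo n; split.
  by rewrite -[X in measurable X]setTI; exact: mg.
rewrite /pushforward -comp_preimage (_ : g \o f = id)//.
by apply/funext => x /=; exact: fK.
Qed.

End SigmaFinite.

Lemma sigma_finite_product (R : realType) d1 d2 (T1 : measurableType d1)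
    (T2 : measurableType d2) (m1 : {sigma_finite_measure set T1 -> \bar R})
    (m2 : {sigma_finite_measure set T2 -> \bar R}) :
  exists m : {sigma_finite_measure set (T1 * T2)%type -> \bar R},
    (m : set (T1 * T2) -> \bar R) = (m1 \x m2)%E.
Proof.
have /sigma_finiteP[F [FT Fnd Foo]] := sigma_finiteT m1.
have /sigma_finiteP[G [GT Gnd Goo]] := sigma_finiteT m2.
apply: (sigma_finite_measureP (m := (m1 \x m2)%E)).
exists (fun n => F n `*` G n) => [|n].
  apply/esym/seteqP; split=> // -[x y] _.
  have [n _ Fx] : (\bigcup_n F n) x by rewrite -FT.
  have [k _ Gy] : (\bigcup_n G n) y by rewrite -GT.
  exists (maxn n k) => //; split.
    by have /subsetPset := Fnd _ _ (leq_maxl n k); exact.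
  by have /subsetPset := Gnd _ _ (leq_maxr n k); exact.
have [[mF Fn] [mG Gn]] := (Foo n, Goo n); split; first exact: measurableX.
by rewrite /= product_measure1E// lte_mul_pinfty// ge0_fin_numE.
Qed.

Section VolumeMeasure.
Context {R : realType}.

(** The recursion defining the volume is the product of the Lebesgue measure of
   the first coordinate with the volume in dimension d, seen through the
   bijection [row_mx].  The equality of set functions makes the volume itself
   available as a measure. *)
Lemma volume_measureP d :
  exists mu : {sigma_finite_measure set (borel_space R d) -> \bar R},
    (mu : set _ -> \bar R) = @volume R d.
Proof.
elim: d => [|d [mu muE]].
  by exists (dirac (0 : borel_space R 0)); apply/funext.
pose f (xv : measurableTypeR R * borel_space R d) : borel_space R d.+1 :=
  (row_mx (xv.1%:M : 'rV_1) xv.2 : 'rV[R]_d.+1).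
pose g (v : borel_space R d.+1) : measurableTypeR R * borel_space R d :=
  ((v : 'rV_d.+1) 0 0, \row_i (v : 'rV_d.+1) 0 (lift ord0 i)).
have mg : measurable_fun setT g.
  apply: measurable_fun_pair; first exact: measurable_coord.
  apply: measurable_coordP => i; under eq_fun do rewrite mxE.
  exact: measurable_coord.
have fK : cancel f g.
  move=> [x v]; rewrite /f /g/=; congr pair.
    by rewrite mxE; case: splitP => // j _; rewrite !mxE !ord1 eqxx.
  apply/rowP => i; rewrite !mxE; case: splitP => [j|j] /=.
    by rewrite ord1.
  by move=> [] ij; congr (v _ _); exact/val_inj.
have [pm pmE] := sigma_finite_product (@lebesgue_measure R) mu.
have [m mE] := sigma_finite_pushforward pm (@measurable_row_mx R d) mg fK.
exists m; rewrite mE; apply/funext => A /=.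
rewrite /pushforward pmE /product_measure1; apply: eq_integral => x _ /=.
rewrite muE; congr volume; apply/seteqP; split=> v /=.
  by rewrite /xsection/= inE.
by rewrite /xsection/= inE.
Qed.

Definition volume_measure d :
    {sigma_finite_measure set (borel_space R d) -> \bar R} :=
  projT1 (cid (volume_measureP d)).

Lemma volume_measureE d A : volume_measure d A = volume A.
Proof. by rewrite /volume_measure; case: cid => /= mu ->. Qed.

(** * Translation invariance *)

Lemma lebesgue_measureD (c : R) (A : set R) : measurable A ->
  pushforward (@lebesgue_measure R) (fun x => x + c : measurableTypeR R) A =
  lebesgue_measure A.
Proof.
have mc : measurable_fun setT (fun x : measurableTypeR R => x + c : measurableTypeR R).
  by apply: measurable_funD; [exact: measurable_id|exact: measurable_cst].
have [m mE] := pushforward_measureP (@lebesgue_measure R) mc.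
move=> mA; rewrite -mE; apply/esym/lebesgue_measure_unique => //= _ [[a b]] _ <-.
rewrite mE /pushforward (_ : _ @^-1` _ = `]a - c, b - c]%classic).
  rewrite lebesgue_measure_itv [RHS]lebesgue_measure_itv/= !lte_fin ltrD2r; case: ifPn => // _.
  by rewrite -!EFinB opprB addrA subrK.
by apply/seteqP; split=> x /=; rewrite !in_itv/= ltrBlDr lerBrDr.
Qed.

Lemma measurable_shift d (w : 'rV[R]_d) :
  measurable_fun setT (fun v : borel_space R d => (v : 'rV_d) + w : borel_space R d).
Proof.
apply: measurable_coordP => i; under eq_fun do rewrite mxE.
apply: measurable_funD; [exact: measurable_coord|exact: measurable_cst].
Qed.

Lemma measurable_preimage d1 d2 (T1 : measurableType d1)
    (T2 : measurableType d2) (f : T1 -> T2) (A : set T2) :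
  measurable_fun setT f -> measurable A -> measurable (f @^-1` A).
Proof. by move=> mf mA; rewrite -[X in measurable X]setTI; exact: mf. Qed.

(** Induction on the dimension: the sections of the translate along the first
   coordinate are translates of the sections. *)
Lemma volume_shift d (w : 'rV[R]_d) (A : set (borel_space R d)) :
  measurable A -> volume [set v | A (v + w)] = volume A.
Proof.
elim: d w A => [|d IH] w A mA.
  by congr volume; apply/seteqP; split=> v /=;
    rewrite (_ : v + w = v)//; apply/rowP => -[].
pose F x := volume [set v : 'rV_d | A (row_mx (x%:M : 'rV_1) v)].
have mS x : measurable ([set v : 'rV_d | A (row_mx (x%:M : 'rV_1) v)] : set (borel_space R d)).
  apply: (@measurable_preimage _ _ (borel_space R d) (borel_space R d.+1)
    (fun v => row_mx (x%:M : 'rV_1) v : 'rV[R]_d.+1)) => //.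
  apply: (measurableT_comp (@measurable_row_mx R d)
    (measurable_fun_pair (measurable_cst (x : measurableTypeR R)) (@measurable_id _ (borel_space R d) setT))).
have mF : measurable_fun setT (F : measurableTypeR R -> \bar R).
  have := @measurable_fun_xsection _ _ (measurableTypeR R) (borel_space R d) R
    (volume_measure d) _ (measurable_preimage (@measurable_row_mx R d) mA).
  congr measurable_fun; apply/funext => x /=; rewrite volume_measureE; congr volume.
  by apply/seteqP; split=> v /=; rewrite /xsection/= inE.
have F0 x : (0 <= F x)%E by rewrite /F -volume_measureE.
pose c := w 0 0.
transitivity (\int[@lebesgue_measure R]_x F (x + c)%R)%E => /=.
  apply: eq_integral => x _; rewrite /F.
  rewrite -[RHS](IH (\row_i w 0 (lift ord0 i)) _ (mS _)); congr volume.
  apply: eq_set => v; congr (A _); rewrite [w in LHS]row_mx0E.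
  by rewrite [LHS](@add_row_mx _ 1 1 d) -raddfD.
have mc : measurable_fun setT (fun x : measurableTypeR R => x + c : measurableTypeR R).
  by apply: measurable_funD; [exact: measurable_id|exact: measurable_cst].
have [m mE] := pushforward_measureP (@lebesgue_measure R) mc.
have := @ge0_integral_pushforward _ _ _ _ _ _ mc (@lebesgue_measure R) setT F measurableT mF (fun x _ => F0 x).
rewrite preimage_setT => <-; rewrite -mE; apply: eq_measure_integral => B mB _.
by rewrite mE; exact: lebesgue_measureD.
Qed.

End VolumeMeasure.

(** * Volume under linear maps *)

Section Haar.
Context {R : realType} (d : nat).
Local Notation T := (borel_space R d).
Implicit Types (A E : set T) (v w x y : 'rV[R]_d).

Lemma measurable_add2 :
  measurable_fun setT (fun z : T * T => (z.1 : 'rV_d) + (z.2 : 'rV_d) : T).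
Proof.
apply: measurable_coordP => i; under eq_fun do rewrite mxE.
apply: measurable_funD; apply: (measurableT_comp (@measurable_coord R d i)).
  exact: measurable_fst.
exact: measurable_snd.
Qed.

Lemma measurable_sub2 :
  measurable_fun setT (fun z : T * T => (z.2 : 'rV_d) - (z.1 : 'rV_d) : T).
Proof.
apply: measurable_coordP => i; under eq_fun do rewrite !mxE.
apply: measurable_funB; apply: (measurableT_comp (@measurable_coord R d i)).
  exact: measurable_snd.
exact: measurable_fst.
Qed.

Lemma section_integrals (m1 m2 : {sigma_finite_measure set T -> \bar R})
    (S : set (T * T)) : measurable S ->
  (\int[m1]_x m2 [set y | S (x, y)] = \int[m2]_y m1 [set x | S (x, y)])%E.
Proof.
move=> mS; have := @indic_fubini_tonelli _ _ T T R m1 m2 S mS.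
rewrite indic_fubini_tonelli_FE// indic_fubini_tonelli_GE//= => h.
transitivity (\int[m1]_x m2 (xsection S x))%E.
  apply: eq_integral => x _; congr (m2 _).
  by apply/seteqP; split=> y /=; rewrite /xsection/= inE.
rewrite [LHS]h; apply: eq_integral => y _; congr (m1 _).
by apply/seteqP; split=> x /=; rewrite /ysection/= inE.
Qed.

Lemma integral_restr_cst (m : {measure set T -> \bar R}) A (c : \bar R) :
  measurable A -> (0 <= c)%E ->
  (\int[m]_y (if y \in A then c else 0) = c * m A)%E.
Proof.
move=> mA c0; rewrite -integral_mkcond.
by rewrite integral_cst.
Qed.

(** Integrating the indicator of {(x, y) | x + y in A, y in E} over y last gives
   nu(A) vol(E).  Over x last, the substitution y := y - x turns it into the
   indicator of {(x, y) | y in A, y - x in E}, and exchanging the integrals once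
   more gives nu(E) vol(A), since E is symmetric. *)
Lemma volume_unique (nu : {sigma_finite_measure set T -> \bar R}) E A :
  (forall w (B : set T), measurable B -> nu [set v | B (v + w)] = nu B) ->
  measurable E -> (forall v, E (- v) <-> E v) -> measurable A ->
  (nu A * volume E = nu E * volume A)%E.
Proof.
move=> nuD mE symE mA.
pose S1 : set (T * T) := [set z | A ((z.1 : 'rV_d) + (z.2 : 'rV_d)) /\ E z.2].
pose S2 : set (T * T) := [set z | A z.2 /\ E ((z.2 : 'rV_d) - (z.1 : 'rV_d))].
have mS1 : measurable S1.
  apply: measurableI; first exact: (measurable_preimage measurable_add2).
  exact: (measurable_preimage measurable_snd).
have mS2 : measurable S2.
  apply: measurableI; first exact: (measurable_preimage measurable_snd).
  exact: (measurable_preimage measurable_sub2).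
transitivity (\int[volume_measure d]_y nu [set x | S1 (x, y)])%E.
  rewrite -[volume E]volume_measureE -integral_restr_cst//.
  apply: eq_integral => y _ /=; case: ifPn => [/set_mem Ey|/negP Ey].
    by rewrite -(nuD y A)//; congr (nu _); apply/seteqP; split=> x // [].
  rewrite (_ : [set _ | _] = set0) ?measure0//.
  by apply/seteqP; split=> x //= [_ /mem_set].
rewrite -section_integrals//.
transitivity (\int[nu]_x volume_measure d [set y | S2 (x, y)])%E.
  apply: eq_integral => x _; rewrite !volume_measureE.
  rewrite -[RHS](volume_shift x).
    by congr volume; apply/seteqP; split=> y; rewrite /S1/S2/= addrK [y + x]addrC.
  apply: (@measurable_preimage _ _ T (T * T)%type (fun y => (x, y))) => //.
  exact: measurable_fun_pair.
rewrite section_integrals//.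
rewrite -[volume A]volume_measureE -integral_restr_cst//.
apply: eq_integral => y _ /=; case: ifPn => [/set_mem Ay|/negP Ay].
  rewrite -[RHS](nuD (- (y : 'rV_d)) E)//; congr (nu _); apply/seteqP.
  split=> x /=.
    by move=> [_ h]; apply/symE; rewrite opprB.
  by move=> h; split=> //; apply/symE; rewrite opprB.
rewrite (_ : [set _ | _] = set0) ?measure0//.
by apply/seteqP; split=> x //= [/mem_set].
Qed.

Lemma measurable_mulmx (M : 'M[R]_d) :
  measurable_fun setT (fun x : T => (x : 'rV_d) *m M : T).
Proof.
apply: measurable_coordP => i; under eq_fun do rewrite mxE.
apply: measurable_sum => j; apply: measurable_funM; last exact: measurable_cst.
exact: measurable_coord.
Qed.

Definition unit_box : set T := [set v : 'rV_d | forall i, -1 <= v 0 i <= 1].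

Lemma measurable_box (a b : 'I_d -> R) :
  measurable ([set v : 'rV_d | forall i, a i <= v 0 i <= b i] : set T).
Proof.
rewrite (_ : mkset _ = \bigcap_i [set v : 'rV_d | a i <= v 0 i <= b i]).
  apply: fin_bigcap_measurable => [|i _]; first exact: finite_finset.
  apply: (measurable_preimage (A := `[a i, b i]%classic) (measurable_coord i)).
  exact: measurable_itv.
by apply/seteqP; split=> v /= h i; [move=> _; exact: h|exact: h].
Qed.

Lemma volume_unit_box : volume unit_box = (2 ^+ d)%:E.
Proof.
rewrite /unit_box (volume_box (a := fun=> -1) (b := fun=> 1)) => [|i].
  by rewrite prodr_const card_ord opprK.
by rewrite -subr_ge0 opprK.
Qed.

(** The image of the volume under a linear map is again translation-invariant. *)
Lemma volume_mulmxP (M : 'M[R]_d) : M \in unitmx ->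
  exists2 c : \bar R, (0 <= c)%E & forall A, measurable A ->
    volume [set x | A (x *m M)] = (c * volume A)%E.
Proof.
move=> Mu.
have [nu nuE] := sigma_finite_pushforward (volume_measure d)
  (measurable_mulmx M) (measurable_mulmx (invmx M)) (mulmxK Mu).
have nuD w (B : set T) : measurable B -> nu [set v | B (v + w)] = nu B.
  move=> mB; rewrite nuE /pushforward !volume_measureE /=.
  have := @volume_shift R d (w *m invmx M) _
    (measurable_preimage (measurable_mulmx M) mB).
  move=> /= <-; congr volume; apply/seteqP; split=> x /=;
  by rewrite mulmxDl mulmxKV.
exists (nu unit_box * ((2 ^+ d)^-1)%:E)%E => [|A mA].
  by rewrite mule_ge0// lee_fin invr_ge0 exprn_ge0.
have mE : measurable unit_box by exact: measurable_box.
have symE v : unit_box (- v) <-> unit_box v.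
  by split=> h i; have := h i; rewrite !mxE lerN2 (lerNl _ 1) andbC.
have := volume_unique nuD mE symE mA.
rewrite volume_unit_box nuE /pushforward !volume_measureE => h.
by rewrite muleAC -[X in (X * _)%E]h -muleA -EFinM divff ?mule1//.
Qed.

(** The factors of M and of its inverse have product 1, hence cancel, and the
   factor of the diagonal map is read off from the preimage of the unit box.
   Since the set is a preimage, the product of the s_i appears inverted. *)
Lemma volume_conj_diag (M : 'M[R]_d) (s : 'rV[R]_d) A :
  M \in unitmx -> (forall i, 0 < s 0 i) -> measurable A ->
  volume [set x | A (x *m invmx M *m diag_mx s *m M)] =
  ((\prod_i s 0 i)^-1%:E * volume A)%E.
Proof.
move=> Mu s0 mA.
have mM (N : 'M[R]_d) (B : set T) : measurable B -> measurable ([set x | B (x *m N)] : set T).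
  exact: measurable_preimage (measurable_mulmx N).
have [c c0 cE] := volume_mulmxP Mu.
have [c' c'0 c'E] : exists2 c : \bar R, (0 <= c)%E & forall A, measurable A ->
    volume [set x | A (x *m invmx M)] = (c * volume A)%E.
  by apply: volume_mulmxP; rewrite unitmx_inv.
have Du : diag_mx s \in unitmx.
  rewrite unitmxE det_diag unitfE; apply/prodf_neq0 => i _.
  by rewrite gt_eqF.
have [b b0 bE] := volume_mulmxP Du.
have mB : measurable unit_box by exact: measurable_box.
have p2 : 2 ^+ d != 0 :> R by rewrite expf_neq0// pnatr_eq0.
have cc' : (c * c' = 1)%E.
  have : (c * c' * volume unit_box = volume unit_box)%E.
    rewrite -muleA -c'E// -cE; last exact: mM.
    by congr volume; apply/seteqP; split=> x /=; rewrite mulmxK.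
  rewrite volume_unit_box => /(congr1 (fun z => z * ((2 ^+ d)^-1)%:E)%E).
  by rewrite -muleA -EFinM divff// mule1.
have bs : b = ((\prod_i s 0 i)^-1)%:E.
  have := bE _ mB; rewrite volume_unit_box.
  rewrite (_ : mkset _ = [set x : 'rV_d | forall i, - (s 0 i)^-1 <= x 0 i <= (s 0 i)^-1]).
    rewrite (volume_box (a := fun i => - (s 0 i)^-1) (b := fun i => (s 0 i)^-1)); last first.
      by move=> i; apply: (@le_trans _ _ 0); rewrite ?oppr_le0 invr_ge0 ltW.
    move=> /(congr1 (fun z => z * ((2 ^+ d)^-1)%:E)%E).
    rewrite -[RHS]muleA -!EFinM divff// mule1 => <-; congr EFin.
    rewrite -prodfV -[2 ^+ d](_ : \prod_(i < d) 2 = _); last first.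
      by rewrite prodr_const card_ord.
    rewrite -prodfV -big_split/=; apply: eq_bigr => i _.
    by rewrite opprK mulrDl -splitr.
  have e (x : 'rV[R]_d) i : (-1 <= (x *m diag_mx s) 0 i <= 1) =
      (- (s 0 i)^-1 <= x 0 i <= (s 0 i)^-1).
    rewrite mul_mx_diag mxE -!ler_norml normrM (gtr0_norm (s0 i)).
    by rewrite -ler_pdivlMr// div1r.
  by apply/seteqP; split=> x /= h i; have := h i; rewrite e.
rewrite (c'E [set x | A (x *m diag_mx s *m M)]); last first.
  exact: (mM _ _ (mM _ _ mA)).
rewrite (bE [set x | A (x *m M)]); last exact: mM.
rewrite cE// -bs muleCA; congr (_ * _)%E.
by rewrite muleA (muleC c') cc' mul1e.
Qed.

End Haar.

(** * Euclidean geometry *)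

Section Dotp.
Context {R : realType} {d : nat}.
Implicit Types (u v w : 'rV[R]_d).

Lemma dotpC u v : dotp u v = dotp v u.
Proof. by apply: eq_bigr => i _; rewrite mulrC. Qed.

Lemma dotpDl u v w : dotp (u + v) w = dotp u w + dotp v w.
Proof. by rewrite -big_split; apply: eq_bigr => i _; rewrite mxE mulrDl. Qed.

Lemma dotpZl a u v : dotp (a *: u) v = a * dotp u v.
Proof. by rewrite mulr_sumr; apply: eq_bigr => i _; rewrite mxE mulrA. Qed.

Lemma dotpNl u v : dotp (- u) v = - dotp u v.
Proof. by rewrite -scaleN1r dotpZl mulN1r. Qed.

Lemma dotpBl u v w : dotp (u - v) w = dotp u w - dotp v w.
Proof. by rewrite dotpDl dotpNl. Qed.

Lemma dotpDr u v w : dotp w (u + v) = dotp w u + dotp w v.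
Proof. by rewrite ![dotp w _]dotpC dotpDl. Qed.

Lemma dotpZr a u v : dotp u (a *: v) = a * dotp u v.
Proof. by rewrite ![dotp u _]dotpC dotpZl. Qed.

Lemma dotpBr u v w : dotp w (u - v) = dotp w u - dotp w v.
Proof. by rewrite ![dotp w _]dotpC dotpBl. Qed.

Lemma dotp_sumr (I : finType) (P : pred I) (F : I -> 'rV[R]_d) u :
  dotp u (\sum_(i | P i) F i) = \sum_(i | P i) dotp u (F i).
Proof.
apply: (big_morph (dotp u)) => [v w|]; first exact: dotpDr.
by rewrite -[0](scale0r 0) dotpZr mul0r.
Qed.

Lemma dotp_ge0 u : 0 <= dotp u u.
Proof. by apply: sumr_ge0 => i _; rewrite -expr2 sqr_ge0. Qed.

Lemma dotp_coord_le u i : u 0 i ^+ 2 <= dotp u u.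
Proof.
rewrite /dotp (bigD1 i)//= -expr2 lerDl.
by apply: sumr_ge0 => j _; rewrite -expr2 sqr_ge0.
Qed.

Lemma dotp_eq0 u : dotp u u = 0 -> u = 0.
Proof.
move=> u0; apply/rowP => i; rewrite mxE; apply/eqP; rewrite -sqrf_eq0.
by rewrite eq_le sqr_ge0 -u0 dotp_coord_le.
Qed.

(** The square of the norm of <v, v> u - <u, v> v is nonnegative. *)
Lemma cauchy_schwarz u v : dotp u v ^+ 2 <= dotp u u * dotp v v.
Proof.
have [v0|v0] := eqVneq (dotp v v) 0.
  by rewrite (dotp_eq0 v0) -(scale0r (0 : 'rV_d)) !dotpZr !mul0r mulr0 expr0n.
have vp : 0 < dotp v v by rewrite lt_def v0 dotp_ge0.
have := dotp_ge0 (dotp v v *: u - dotp u v *: v).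
rewrite dotpBl !dotpBr !dotpZl !dotpZr (dotpC v u) => h.
rewrite -subr_ge0 -(pmulr_rge0 _ vp); apply: le_trans h _.
by rewrite le_eqVlt; apply/orP; left; apply/eqP; ring.
Qed.

Lemma enorm_ge0 u : 0 <= enorm u. Proof. exact: sqrtr_ge0. Qed.

Lemma sqr_enorm u : enorm u ^+ 2 = dotp u u.
Proof. by rewrite sqr_sqrtr// dotp_ge0. Qed.

Lemma enorm_le r u : 0 <= r -> (enorm u <= r) = (dotp u u <= r ^+ 2).
Proof. by move=> r0; rewrite -sqr_enorm ler_sqr// nnegrE enorm_ge0. Qed.

Lemma enorm0_eq0 u : enorm u = 0 -> u = 0.
Proof. by move=> u0; apply: dotp_eq0; rewrite -sqr_enorm u0 expr0n. Qed.

Lemma enormZ a u : enorm (a *: u) = `|a| * enorm u.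
Proof.
by rewrite /enorm dotpZl dotpZr mulrA -expr2 sqrtrM ?sqr_ge0// sqrtr_sqr.
Qed.

Lemma dotp_le_enorm u v : dotp u v <= enorm u * enorm v.
Proof.
rewrite -[_ * _]ger0_norm ?mulr_ge0 ?enorm_ge0//.
apply: le_trans (ler_norm _) _.
by rewrite -ler_sqr ?nnegrE// !real_normK ?num_real// exprMn !sqr_enorm cauchy_schwarz.
Qed.

Lemma coord_le_enorm u i : `|u 0 i| <= enorm u.
Proof.
by rewrite -ler_sqr ?nnegrE ?enorm_ge0// real_normK ?num_real// sqr_enorm dotp_coord_le.
Qed.

Lemma mulmx_trE u v : (u *m v^T) 0 0 = dotp u v.
Proof. by rewrite mxE; apply: eq_bigr => i _; rewrite mxE. Qed.

End Dotp.

(** The rows of A and their orthogonal complement span R^d, and the map which is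
   the identity on the former and r on the latter is diagonal in a basis adapted
   to this decomposition.  Gaussian elimination A = C P U, with P a partial
   identity, provides one: the first rows of U span the rows of A, and the last
   rows of the transposed inverse of U span their orthogonal complement.  The
   basis M and the number m of eigenvalues 1 do not depend on r. *)
Lemma orthogonal_scaling (R : realType) n d (A : 'M[R]_(n, d)) :
  exists (m : nat) (M : 'M[R]_d), [/\ (m <= d)%N, M \in unitmx &
    forall r : R, let L := invmx M *m diag_mx (\row_(i < d) if (i < m)%N then 1 else r) *m M in
      A *m L = A /\
      forall z : 'rV_d, (forall k, dotp z (row k A) = 0) -> z *m L = r *: z].
Proof.
pose k := \rank A; pose U := row_ebase A.
have Uu : U \in unitmx by exact: row_ebase_unit.
pose P : 'M[R]_d := pid_mx k; pose Q : 'M[R]_d := copid_mx k.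
pose M := P *m U + Q *m invmx U^T.
have kd : (k <= d)%N by exact: rank_leq_col.
have kn : (k <= n)%N by exact: rank_leq_row.
have PP : P *m P = P by rewrite pid_mx_id.
have PQ : P *m Q = 0 by rewrite mul_pid_mx_copid.
have QP : Q *m P = 0 by rewrite mul_copid_mx_pid.
have QQ : Q *m Q = Q by rewrite copid_mx_id.
have PQ1 : P + Q = 1%:M by rewrite /Q /copid_mx addrC subrK.
have UTu : U^T \in unitmx by rewrite unitmx_tr.
have PM : P *m M = P *m U by rewrite mulmxDr !mulmxA PP PQ mul0mx addr0.
have QM : Q *m M = Q *m invmx U^T by rewrite mulmxDr !mulmxA QP QQ mul0mx add0r.
(* if v M = 0 then a = v P U and b = v Q U^-T are orthogonal and opposite *)
have Mu : M \in unitmx.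
  rewrite -row_free_unit; apply/row_freeP/row_freeP; rewrite -kermx_eq0.
  apply/eqP/row_matrixP => i; rewrite row0.
  set v := row i _.
  have vM : v *m M = 0 by apply/sub_kermxP; exact: row_sub.
  pose a := v *m P *m U; pose b := v *m Q *m invmx U^T.
  have ab : a = - b by apply/eqP; rewrite -addr_eq0 -vM mulmxDr !mulmxA.
  have abT : a *m b^T = 0.
    rewrite /a /b !trmx_mul trmx_inv trmxK !mulmxA mulmxK// -(mulmxA v).
    have -> : Q^T = Q by rewrite /Q /copid_mx linearB/= trmx1 tr_pid_mx.
    by rewrite PQ mulmx0 mul0mx.
  have a0 : a = 0.
    have ab0 : dotp a b = 0.
      by rewrite -mulmx_trE abT mxE.
    by apply: dotp_eq0; rewrite {2}ab dotpC dotpNl dotpC ab0 oppr0.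
  have vP : v *m P = 0 by rewrite -[LHS](mulmxK Uu) -/a a0 mul0mx.
  have b0 : b = 0 by rewrite -[b]opprK -ab a0 oppr0.
  have vQ : v *m Q = 0 by rewrite -[LHS](mulmxKV UTu) -/b b0 mul0mx.
  by rewrite -[v]mulmx1 -PQ1 mulmxDr vP vQ addr0.
exists k, M; split=> // r /=.
have -> : diag_mx (\row_(i < d) if (i < k)%N then 1 else r) = P + r *: Q.
  apply/matrixP => i j; rewrite !mxE.
  have [ij|ij] := eqVneq i j; last by rewrite /= (negbTE (_ : (i : nat) != j))// !mulr0n subr0 mulr0 addr0.
  by rewrite ij eqxx /=; case: ifP => _; rewrite /= !mulr1n ?subrr ?subr0 ?mulr0 ?addr0 ?mulr1 ?add0r.
have PD : P *m (P + r *: Q) = P by rewrite mulmxDr PP -scalemxAr PQ scaler0 addr0.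
have QD : Q *m (P + r *: Q) = r *: Q by rewrite mulmxDr QP -scalemxAr QQ add0r.
split.
  have AE : A = col_ebase A *m (pid_mx k : 'M[R]_(n, d)) *m P *m M.
    by rewrite -!mulmxA PM !mulmxA -(mulmxA (col_ebase A)) pid_mx_id// mulmx_ebase.
  rewrite {1}AE !mulmxA mulmxK// -(mulmxA _ P) PD.
  by rewrite {2}AE.
move=> z zA.
have zAT : z *m A^T = 0.
  apply/rowP => j; rewrite !mxE -[RHS](zA j); apply: eq_bigr => i _.
  by rewrite !mxE.
have zUP : z *m U^T *m P = 0.
  have : z *m A^T *m invmx (col_ebase A)^T *m (pid_mx k : 'M[R]_(n, d)) = 0.
    by rewrite zAT !mul0mx.
  rewrite -{1}[A]mulmx_ebase !trmx_mul !mulmxA mulmxK ?unitmx_tr ?col_ebase_unit//.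
  by rewrite tr_pid_mx -(mulmxA _ (pid_mx _)) pid_mx_id.
have zE : z = z *m U^T *m Q *m M.
  rewrite -mulmxA QM mulmxA -[LHS](mulmxK UTu); congr (_ *m _).
  by rewrite -[LHS]mulmx1 -PQ1 mulmxDr zUP add0r.
rewrite {1}zE !mulmxA mulmxK// -(mulmxA _ Q) QD -scalemxAr -scalemxAl.
by rewrite -zE.
Qed.

(** * Nearest points of a polytope *)

Section NearestPoint.
Context {R : realType} (N d : nat).
Implicit Types (p : 'I_N -> 'rV[R]_d) (I J : {set 'I_N}) (x y z : 'rV[R]_d).

Lemma hull_vertex I p i : i \in I -> hull I p (p i).
Proof.
move=> iI; exists (fun j => (j == i)%:R).
  split=> [j|]; first exact: ler0n.
  rewrite (bigD1 i)//= eqxx big1 ?addr0// => j /andP[_ /negbTE ->].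
  by [].
rewrite (bigD1 i)//= eqxx scale1r big1 ?addr0// => j /andP[_ /negbTE ->].
by rewrite scale0r.
Qed.

Lemma hull_segment I p x y (t : R) : 0 <= t <= 1 ->
  hull I p x -> hull I p y -> hull I p (x + t *: (y - x)).
Proof.
move=> /andP[t0 t1] [a [a0 a1] ->] [b [b0 b1] ->].
exists (fun i => (1 - t) * a i + t * b i).
  split=> [i|]; first by rewrite addr_ge0// mulr_ge0// subr_ge0.
  by rewrite big_split/= -!mulr_sumr a1 b1 !mulr1 subrK.
rewrite -sumrB scaler_sumr -big_split/=; apply: eq_bigr => i _.
by rewrite -scalerBl scalerA -scalerDl; congr (_ *: _); ring.
Qed.

Lemma hull_dotp_le I p z x (c : R) : hull I p x ->
  (forall i, i \in I -> dotp z (p i) <= c) -> dotp z x <= c.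
Proof.
move=> [w [w0 w1] ->] h; rewrite dotp_sumr -[c]mul1r -w1 mulr_suml.
by apply: ler_sum => i iI; rewrite dotpZr ler_wpM2l// h.
Qed.

Lemma sum_continuous n (P : pred 'I_n) (T : topologicalType) (F : 'I_n -> T -> R) :
  (forall i, continuous (F i)) -> continuous (fun t => \sum_(i | P i) F i t).
Proof. by move=> cF; apply: continuous_big => // z; exact: add_continuous. Qed.

Lemma compact_weights I :
  compact [set w : 'rV[R]_N | (forall i, w 0 i \in `[0, 1]) /\ \sum_(i in I) w 0 i = 1].
Proof.
rewrite (_ : mkset _ = [set w : 'rV[R]_N | forall i, w ord0 i \in `[0, 1]] `&`
    (fun w : 'rV[R]_N => \sum_(i in I) w 0 i) @^-1` [set 1]) //.
apply: compact_closedI.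
  by apply: (@rV_compact _ _ (fun=> `[(0 : R), 1]%classic)) => i; exact: segment_compact.
apply: preimage_closed; last exact: closed_eq.
by move=> w _; apply: sum_continuous => i; exact: coord_continuous.
Qed.

(** The distance to x is minimized over the compact set of the weights rather than
   over the hull itself. *)
Lemma nearest_point_min I p x : I != finset.set0 ->
  exists2 y, hull I p y & forall y', hull I p y' ->
    dotp (x - y) (x - y) <= dotp (x - y') (x - y').
Proof.
move=> /set0Pn[i0 i0I].
pose W := [set w : 'rV[R]_N | (forall i, w 0 i \in `[0, 1]) /\ \sum_(i in I) w 0 i = 1].
pose g (w : 'rV[R]_N) := x - \sum_(i in I) w 0 i *: p i.
have W0 : W !=set0.
  exists (\row_i (i == i0)%:R); split=> [i|].
    by rewrite mxE in_itv/= ler0n lern1 leq_b1.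
  rewrite (bigD1 i0)//= mxE eqxx big1 ?addr0// => j /andP[_ /negbTE jE].
  by rewrite mxE jE.
have cf : {within W, continuous (fun w => dotp (g w) (g w))}.
  apply: continuous_subspaceT; apply: sum_continuous => j.
  have cg : continuous (fun w => g w 0 j).
    rewrite (_ : (fun w : 'rV_N => _) = fun w : 'rV_N => x 0 j - \sum_(i in I) w 0 i * p i 0 j).
      have cs : continuous (fun w : 'rV[R]_N => \sum_(i in I) w 0 i * p i 0 j).
        apply: sum_continuous => i w.
        by apply: (@continuousM R _ (fun w : 'rV[R]_N => w 0 i) (fun=> p i 0 j));
          [exact: coord_continuous|exact: cst_continuous].
      move=> w.
      have c0 : (x 0 j : R) @[_ --> w] --> (x 0 j : R) by exact: cst_continuous.
      exact: cvgB c0 (cs w).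
    apply/funext => w; rewrite !mxE summxE; congr (_ - _).
    by apply: eq_bigr => i _; rewrite mxE.
  by move=> w; apply: (@continuousM R _ (fun w => g w 0 j)); exact: cg.
have [w /set_mem[w01 w1] wmin] := EVT_min_rV W0 (@compact_weights I) cf.
exists (\sum_(i in I) w 0 i *: p i) => [|y' [w' [w'0 w'1] ->]].
  exists (fun i => w 0 i) => //; split=> // i.
  by have := w01 i; rewrite in_itv/= => /andP[].
pose v : 'rV_N := \row_i (if i \in I then w' i else 0).
have vE i : i \in I -> v 0 i = w' i by rewrite mxE => ->.
have vW : v \in W.
  apply/mem_set; split=> [i|]; last by rewrite -w'1; exact: eq_bigr.
  rewrite in_itv/= mxE; case: ifPn => iI; rewrite ?lexx ?ler01//.
  rewrite w'0 -w'1 (bigD1 i)//= lerDl sumr_ge0//.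
have gv : g v = x - \sum_(i in I) w' i *: p i.
  by rewrite /g; congr (_ - _); apply: eq_bigr => i iI; rewrite vE.
by have := wmin _ vW; rewrite /= gv.
Qed.

Lemma dotp_le0_of_min z v :
  (forall t, 0 <= t <= 1 -> dotp z z <= dotp (z - t *: v) (z - t *: v)) ->
  dotp z v <= 0.
Proof.
move=> zmin; rewrite leNgt; apply/negP => zv.
have vv := dotp_ge0 v.
have den : 0 < dotp z v + dotp v v by rewrite ltr_wpDr.
(* the minimizer of |z - t v|^2, made smaller so as to be at most 1 *)
pose t := dotp z v / (dotp z v + dotp v v).
have t0 : 0 < t by rewrite divr_gt0.
have t1 : t <= 1 by rewrite ler_pdivrMr// mul1r lerDl.
have := zmin t; rewrite (ltW t0) t1 => /(_ isT).
rewrite dotpBl !dotpBr !dotpZl !dotpZr (dotpC v z).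
have tE : t * (dotp z v + dotp v v) = dotp z v by rewrite divfK// gt_eqF.
rewrite (_ : _ - _ = dotp z z - t * (dotp z v + t * dotp z v)); last first.
  have -> : t * dotp v v = dotp z v - t * dotp z v.
    by rewrite -{1}tE mulrDr addrC addKr.
  by ring.
by rewrite lerDl oppr_ge0 leNgt mulr_gt0// addr_gt0// mulr_gt0.
Qed.

(** At the nearest point y, the vector x - y makes an obtuse angle with every
   segment from y to a point of the hull; the vertices suffice to characterize y. *)
Lemma nearest_point I p x : I != finset.set0 ->
  exists y, hull I p y /\ forall i, i \in I -> dotp (x - y) (p i - y) <= 0.
Proof.
move=> I0; have [y Ky ymin] := nearest_point_min p x I0.
exists y; split=> // i iI; apply: dotp_le0_of_min => t t01.
have := ymin _ (hull_segment t01 Ky (hull_vertex p iI)).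
by rewrite opprD addrA.
Qed.

(** The variational inequalities alone imply that the nearest point is unique and
   is a 1-Lipschitz function of x.  Adding those of y and y' gives
   |y - y'|^2 <= <x - x', y - y'>. *)
Lemma nearest_point_monotone I p x y x' y' :
  hull I p y -> (forall i, i \in I -> dotp (x - y) (p i - y) <= 0) ->
  hull I p y' -> (forall i, i \in I -> dotp (x' - y') (p i - y') <= 0) ->
  dotp (y - y') (y - y') <= dotp (x - x') (x - x').
Proof.
have shift u v w : dotp u (v - w) <= 0 -> dotp u v <= dotp u w.
  by rewrite dotpBr subr_le0.
move=> Ky yP Ky' y'P.
have h1 : dotp (x - y) y' <= dotp (x - y) y.
  by apply: hull_dotp_le Ky' _ => i /yP/shift.
have h2 : dotp (x' - y') y <= dotp (x' - y') y'.
  by apply: hull_dotp_le Ky _ => i /y'P/shift.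
have h3 : dotp (y - y') (y - y') <= dotp (x - x') (y - y').
  move: h1 h2; rewrite !dotpBl !dotpBr => ? ?; lra.
have := dotp_ge0 ((x - x') - (y - y')); rewrite dotpBl dotpBr [X in _ - X]dotpBr (dotpC (y - y')).
move: h3; move: (dotp _ _) (dotp _ _) (dotp _ _) => a b c; lra.
Qed.

Lemma nearest_fun I p : I != finset.set0 ->
  exists rho : 'rV[R]_d -> 'rV[R]_d,
    (forall x, hull I p (rho x)) /\
    forall x i, i \in I -> dotp (x - rho x) (p i - rho x) <= 0.
Proof.
move=> I0.
have /choice[rho rhoP] : forall x, exists y, hull I p y /\
    forall i, i \in I -> dotp (x - y) (p i - y) <= 0.
  by move=> x; exact: nearest_point.
by exists rho; split=> x; have [] := rhoP x.
Qed.

End NearestPoint.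

(** * The normal decomposition of a parallel body *)

Lemma measurable_dotp (R : realType) d disp (X : measurableType disp)
    (f g : X -> 'rV[R]_d) :
  measurable_fun setT (f : X -> borel_space R d) ->
  measurable_fun setT (g : X -> borel_space R d) ->
  measurable_fun setT (fun x => dotp (f x) (g x)).
Proof.
move=> mf mg; apply: measurable_sum => i.
by apply: measurable_funM; apply: (measurableT_comp (@measurable_coord R d i)).
Qed.

Lemma measurable_enorm (R : realType) d disp (X : measurableType disp)
    (f : X -> 'rV[R]_d) :
  measurable_fun setT (f : X -> borel_space R d) ->
  measurable_fun setT (fun x => enorm (f x)).
Proof.
move=> mf; apply: (measurableT_comp (f := @Num.sqrt R)); last exact: measurable_dotp.
apply: continuous_measurable_fun; exact: sqrt_continuous.
Qed.

Lemma measurable_le_set (R : realType) disp (X : measurableType disp) (f g : X -> R) :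
  measurable_fun setT f -> measurable_fun setT g ->
  measurable [set x | f x <= g x].
Proof. by move=> mf mg; rewrite -[mkset _]setTI; exact: measurable_fun_le. Qed.

Lemma measurable_finset_fiber disp (X : measurableType disp) (I : finType)
    (F : X -> {set I}) (J : {set I}) :
  (forall i, measurable [set x | i \in F x]) -> measurable [set x | F x = J].
Proof.
move=> mF; rewrite (_ : mkset _ = \bigcap_i [set x | (i \in F x) = (i \in J)]).
  apply: fin_bigcap_measurable => [|i _]; first exact: finite_finset.
  case: (i \in J); first exact: mF.
  rewrite (_ : mkset _ = ~` [set x | i \in F x]); first exact/measurableC/mF.
  by apply/seteqP; split=> x /=; [move=> ->|move/negP/negbTE].
apply/seteqP; split=> [x FJ i _|x h] /=; first by rewrite -FJ.
by apply/setP => i; exact: h.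
Qed.

Lemma dotp_sub_ge (R : realType) d (z v : 'rV[R]_d) :
  dotp z v <= 0 -> dotp z z <= dotp (z - v) (z - v).
Proof.
move=> zv; rewrite dotpBl !dotpBr (dotpC v z); have := dotp_ge0 v.
move: (dotp _ _) (dotp _ _) (dotp _ _) zv => *; lra.
Qed.

Section Pieces.
Context {R : realType} (N d : nat) (p : 'I_N -> 'rV[R]_d) (I : {set 'I_N}).
Variable rho : 'rV[R]_d -> 'rV[R]_d.
Hypothesis rho_hull : forall x, hull I p (rho x).
Hypothesis rho_le0 : forall x i, i \in I -> dotp (x - rho x) (p i - rho x) <= 0.
Local Notation T := (borel_space R d).
Implicit Types (J : {set 'I_N}) (x y z : 'rV[R]_d) (r : R).

Lemma rho_unique y z : hull I p y ->
  (forall i, i \in I -> dotp z (p i - y) <= 0) -> rho (y + z) = y.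
Proof.
move=> Ky zP; apply/eqP; rewrite -subr_eq0; apply/eqP/dotp_eq0/eqP.
rewrite eq_le dotp_ge0 andbT.
have zP' i : i \in I -> dotp (y + z - y) (p i - y) <= 0.
  by rewrite addrC addKr; exact: zP.
have := nearest_point_monotone (rho_hull (y + z)) (rho_le0 (y + z)) Ky zP'.
by rewrite subrr -(scale0r (0 : 'rV_d)) !dotpZl mul0r.
Qed.

Lemma measurable_rho : measurable_fun setT (rho : T -> T).
Proof.
apply: measurable_borelP => U oU; apply: open_borel.
rewrite openE => x Ux.
have /nbhs_ballP[e /= e0 eU] : nbhs (rho x) U by exact: open_nbhs_nbhs.
apply/nbhs_ballP; exists (e / d.+1%:R) => /=; first by rewrite divr_gt0.
move=> x' [_ xx']; apply: eU; split=> // k i; rewrite ord1 {k}.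
rewrite /ball/= -ltr_sqr ?nnegrE// ?ltW// real_normK ?num_real//.
have := dotp_coord_le (rho x - rho x') i; rewrite !mxE => h1.
apply: le_lt_trans h1 _.
have h2 := nearest_point_monotone (rho_hull x) (rho_le0 x) (rho_hull x') (rho_le0 x').
apply: le_lt_trans h2 _.
apply: (@le_lt_trans _ _ (\sum_(j < d) (e / d.+1%:R) ^+ 2)).
  apply: ler_sum => j _; rewrite -expr2 -[leLHS]real_normK ?num_real//.
  rewrite ler_sqr ?nnegrE ?divr_ge0 ?(ltW e0)//.
  by have := xx' 0 j; rewrite /ball/= !mxE => /ltW.
rewrite sumr_const card_ord -[ltLHS]mulr_natl expr_div_n mulrCA gtr_pMr ?exprn_gt0//.
rewrite ltr_pdivrMr ?exprn_gt0// mul1r -natrX ltr_nat.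
by rewrite (leq_trans (ltnSn d))// -{1}[d.+1]expn1 leq_pexp2l.
Qed.

(** If x = a + b with a in K, then |x - rho(x)| <= |b| because the angle at rho(x)
   between x and a is obtuse. *)
Lemma minkowski_ballE r : 0 <= r ->
  minkowski_sum (hull I p) (@eball R d r) = [set x | enorm (x - rho x) <= r].
Proof.
move=> r0; apply/seteqP; split=> [_ [a Ka] [b br <-]|x xr] /=; last first.
  by exists (rho x); [exact: rho_hull|exists (x - rho x) => //; rewrite addrC subrK].
rewrite (le_trans _ br)// enorm_le ?enorm_ge0// sqr_enorm.
set z := a + b - rho (a + b); have -> : b = z - (a - rho (a + b)).
  by rewrite /z opprB addrA subrK addrAC subrr add0r.
apply: dotp_sub_ge; rewrite dotpBr subr_le0; apply: hull_dotp_le Ka _ => i iI.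
by rewrite -subr_le0 -dotpBr; exact: rho_le0.
Qed.

(** The index set of the face of the hull exposed by z; indices of coinciding or
   of non-extreme points of the face are included. *)
Definition face z : {set 'I_N} :=
  [set i in I | [forall (j | j \in I), dotp z (p j) <= dotp z (p i)]]%SET.

Lemma faceP z i : reflect
  (i \in I /\ forall j, j \in I -> dotp z (p j) <= dotp z (p i)) (i \in face z).
Proof.
rewrite inE; apply: (iffP andP) => -[iI h]; split=> //.
  by move=> j jI; have /forall_inP := h; apply.
by apply/forall_inP.
Qed.

Lemma face_orth z i j : i \in face z -> j \in face z -> dotp z (p i - p j) = 0.
Proof.
move=> /faceP[iI ih] /faceP[jI jh]; apply/eqP; rewrite dotpBr subr_eq0 eq_le.
by rewrite ih// jh.
Qed.

Lemma faceZ r z : 0 < r -> face (r *: z) = face z.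
Proof.
move=> r0; apply/setP => i; rewrite !inE; congr andb.
by apply: eq_forallb_in => j _; rewrite !dotpZl ler_pM2l.
Qed.

(** Geometrically, the nearest point of x lies on the face J and x - rho(x) is in the
   relative interior of the normal cone of J. *)
Definition piece J r : set T :=
  [set x : 'rV[R]_d | enorm (x - rho x) <= r /\ face (x - rho x) = J].

(** In a convex combination giving the nearest point, only vertices which maximize
   x - rho x can have a positive weight. *)
Lemma hull_face x : hull (face (x - rho x)) p (rho x).
Proof.
set z := x - rho x; set J := face z.
have [w [w0 w1] rE] := rho_hull x.
have zp i : i \in I -> dotp z (p i) <= dotp z (rho x).
  by move=> iI; rewrite -subr_le0 -dotpBr rho_le0.
have sum0 : \sum_(i in I) w i * (dotp z (rho x) - dotp z (p i)) = 0.
  under eq_bigr do rewrite mulrBr.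
  rewrite sumrB -mulr_suml w1 mul1r {1}rE dotp_sumr.
  by under eq_bigr do rewrite dotpZr; rewrite subrr.
have wJ i : i \in I -> i \notin J -> w i = 0.
  move=> iI iJ; apply/eqP.
  have : w i * (dotp z (rho x) - dotp z (p i)) == 0.
    apply/eqP; apply: (psumr_eq0P _ sum0) => // j jI.
    by rewrite mulr_ge0// subr_ge0 zp.
  rewrite mulf_eq0 => /orP[//|]; rewrite subr_eq0 => /eqP zE.
  case/negP: iJ; apply/faceP; split=> // j jI.
  by rewrite -zE zp.
have JI : J \subset I by apply/fintype.subsetP => i /faceP[].
exists w; first split=> //.
  rewrite -w1 [RHS](big_setID J)/= (finset.setIidPr JI) [X in _ + X]big1 ?addr0// => i.
  by rewrite inE => /andP[iJ iI]; rewrite wJ.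
rewrite {1}rE (big_setID J)/= (finset.setIidPr JI) [X in _ + X]big1 ?addr0// => i.
by rewrite inE => /andP[iJ iI]; rewrite wJ// scale0r.
Qed.

(** The description of the pieces which no longer refers to nearest points: rho
   recovers y from y + z by [rho_unique]. *)
Lemma pieceP J r x : piece J r x <->
  exists y z, [/\ x = y + z, hull J p y, face z = J & enorm z <= r].
Proof.
split=> [[xr xJ]|[y [z [-> Jy zJ zr]]]].
  exists (rho x), (x - rho x); split=> //; first by rewrite addrC subrK.
  by rewrite -{1}xJ; exact: hull_face.
have JI i : i \in J -> i \in I by rewrite -zJ => /faceP[].
have Ky : hull I p y.
  have [w [w0 w1] ->] := Jy; exists (fun i => if i \in J then w i else 0).
    split=> [i|]; first by case: ifP.
    rewrite -w1 -big_mkcondr; apply: eq_bigl => i.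
    by apply: andb_idl; exact: JI.
  rewrite [RHS](eq_bigr (fun i => if i \in J then w i *: p i else 0)); last first.
    by move=> i _; case: ifP => _; rewrite ?scale0r.
  rewrite -big_mkcondr; apply: eq_bigl => i.
  by apply/esym/andb_idl; exact: JI.
have zP i : i \in I -> dotp z (p i - y) <= 0.
  move=> iI; rewrite dotpBr subr_le0 -lerN2 -!dotpNl.
  apply: hull_dotp_le Jy _ => j; rewrite -zJ => /faceP[_ h].
  by rewrite !dotpNl lerN2 h.
by rewrite /piece/= rho_unique// addrC addKr.
Qed.

Lemma measurable_disp : measurable_fun setT (fun x : T => (x : 'rV_d) - rho x : T).
Proof.
apply: measurable_coordP => i; under eq_fun do rewrite !mxE.
apply: measurable_funB; first exact: measurable_coord.
exact: (measurableT_comp (@measurable_coord R d i) measurable_rho).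
Qed.

Lemma measurable_piece J r : measurable (piece J r).
Proof.
apply: measurableI.
  apply: measurable_le_set; last exact: measurable_cst.
  exact: measurable_enorm measurable_disp.
apply: measurable_finset_fiber => i.
have [iI|iI] := boolP (i \in I); last first.
  rewrite (_ : mkset _ = set0)//; apply/seteqP; split=> // x /=.
  by rewrite inE (negbTE iI).
rewrite (_ : mkset _ = \bigcap_(j in [set j | j \in I])
    [set x | dotp (x - rho x) (p j) <= dotp (x - rho x) (p i)]).
  apply: fin_bigcap_measurable => [|j _]; first exact: finite_finset.
  apply: measurable_le_set; apply: measurable_dotp => //;
    exact: measurable_disp.
apply/seteqP; split=> [x /= /faceP[_ h] j jI|x /= h]; first exact: h.
by apply/faceP; split=> // j jI; exact: h.
Qed.

End Pieces.

(** * Steiner's formula *)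

Lemma measure_fin_partition disp (X : measurableType disp) (R : realType)
    (mu : {measure set X -> \bar R}) (I : finType) (k : X -> I) (D : set X) :
  (forall i, measurable (D `&` [set x | k x = i])) ->
  mu D = (\sum_i mu (D `&` [set x | k x = i]))%E.
Proof.
move=> mk; rewrite [RHS](@bigfs _ _ _ I _ predT)//; last first.
- by move=> i _; rewrite mem_index_enum.
- exact: index_enum_uniq.
rewrite -measure_fin_bigcup//; last by move=> i j _ _ [x [[_ <-] [_ <-]]].
congr (mu _); apply/seteqP; split=> [x Dx|x [i _ []]//].
by exists (k x).
Qed.

Section VolumeBounds.
Context {R : realType} {d : nat}.
Local Notation T := (borel_space R d).
Implicit Types (A B : set T) (u v : 'rV[R]_d) (r : R).

Lemma volume_ge0 A : (0 <= volume A)%E.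
Proof. by rewrite -[volume A]volume_measureE. Qed.

Lemma le_volume A B : measurable A -> measurable B -> A `<=` B ->
  (volume A <= volume B)%E.
Proof.
by move=> mA mB AB; rewrite -[volume A]volume_measureE -[volume B]volume_measureE le_measure// inE.
Qed.

Lemma measurable_eball r : measurable (@eball R d r : set T).
Proof.
apply: measurable_le_set; last exact: measurable_cst.
exact: (measurable_enorm (f := @id T)).
Qed.

Lemma volume_bounded_lty A r : measurable A -> A `<=` @eball R d r ->
  (volume A < +oo)%E.
Proof.
move=> mA Ar.
pose B : set T := [set v : 'rV[R]_d | forall i, - `|r| <= v 0 i <= `|r|].
have mB : measurable B by exact: (measurable_box (fun=> - `|r|) (fun=> `|r|)).
apply: le_lt_trans (le_volume mA mB _) _.
  move=> v /Ar vr i; rewrite -ler_norml.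
  exact: le_trans (coord_le_enorm v i) (le_trans vr (ler_norm r)).
rewrite /B (volume_box (a := fun=> - `|r|) (b := fun=> `|r|)) ?ltry// => _.
exact: (ge0_cp (normr_ge0 r)).2.
Qed.

Lemma fine_volumeK A r : measurable A -> A `<=` @eball R d r ->
  (fine (volume A))%:E = volume A.
Proof.
move=> mA Ar; rewrite fineK// ge0_fin_numE ?volume_ge0//.
exact: volume_bounded_lty Ar.
Qed.

Lemma enormD u v : enorm (u + v) <= enorm u + enorm v.
Proof.
rewrite enorm_le ?addr_ge0 ?enorm_ge0// sqrrD !sqr_enorm dotpDl !dotpDr (dotpC v u).
have := dotp_le_enorm u v; lra.
Qed.

(** The linear form <u, .> is maximal over the hull at a vertex, and at u it takes
   the value |u|^2. *)
Lemma hull_enorm_le N (p : 'I_N -> 'rV[R]_d) (I : {set 'I_N}) u :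
  hull I p u -> enorm u <= \sum_i enorm (p i).
Proof.
move=> Ku; have [->|u0] := eqVneq (enorm u) 0.
  by apply: sumr_ge0 => i _; exact: enorm_ge0.
have up : 0 < enorm u by rewrite lt_def u0 enorm_ge0.
rewrite -(ler_pM2l up) -expr2 sqr_enorm; apply: hull_dotp_le Ku _ => i iI.
apply: le_trans (dotp_le_enorm _ _) _; rewrite ler_pM2l//.
by rewrite (bigD1 i)//= lerDl; apply: sumr_ge0 => j _; exact: enorm_ge0.
Qed.

End VolumeBounds.

(** The ball contains the cube of half-side 1 / (n + 1). *)
Lemma ball_volume_gt0 (R : realType) n : 0 < ball_volume R n.
Proof.
have n1 : 0 < n.+1%:R^-1 :> R by rewrite invr_gt0.
pose B : set (borel_space R n) := [set v : 'rV[R]_n | forall i, - n.+1%:R^-1 <= v 0 i <= n.+1%:R^-1].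
have mB : measurable B by exact: (measurable_box (fun=> - n.+1%:R^-1) (fun=> n.+1%:R^-1)).
have BE : volume B = (\prod_(i < n) (n.+1%:R^-1 - - n.+1%:R^-1))%:E.
  apply: (volume_box (a := fun=> - n.+1%:R^-1) (b := fun=> n.+1%:R^-1)) => _.
  exact: (ge0_cp (ltW n1)).2.
rewrite -lte_fin (fine_volumeK (r := 1))//; last exact: measurable_eball.
apply: lt_le_trans (le_volume mB (@measurable_eball R n 1) _).
  by rewrite BE lte_fin; apply: prodr_gt0 => i _; rewrite opprK addr_gt0.
move=> v Bv; rewrite /eball/= enorm_le// expr1n.
apply: (@le_trans _ _ (\sum_(i < n) n.+1%:R^-1)).
  apply: ler_sum => i _; rewrite -expr2 -[leLHS]real_normK ?num_real//.
  have := Bv i; rewrite -ler_norml => vi.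
  apply: le_trans (_ : n.+1%:R^-1 ^+ 2 <= _).
    by rewrite ler_sqr// nnegrE ltW.
  by rewrite expr2 ger_pMr// invf_le1// ler1n.
by rewrite sumr_const card_ord -[leLHS]mulr_natl ler_pdivrMr// mul1r ler_nat.
Qed.

Section Steiner.
Context {R : realType} (N d : nat) (p : 'I_N -> 'rV[R]_d) (I : {set 'I_N}).
Variable rho : 'rV[R]_d -> 'rV[R]_d.
Hypothesis rho_hull : forall x, hull I p (rho x).
Hypothesis rho_le0 : forall x i, i \in I -> dotp (x - rho x) (p i - rho x) <= 0.
Local Notation T := (borel_space R d).
Local Notation piece := (piece p I rho).
Local Notation face := (face p I).
Implicit Types (J : {set 'I_N}) (x y z : 'rV[R]_d) (r : R).

Lemma piece_bounded J r : piece J r `<=` @eball R d (\sum_i enorm (p i) + r).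
Proof.
move=> x [xr _]; rewrite /eball/= -[x](subrK (rho x)) addrC.
apply: le_trans (enormD _ _) _; apply: lerD => //.
by apply: hull_enorm_le; exact: rho_hull.
Qed.

Lemma le_piece J r s : r <= s -> piece J r `<=` piece J s.
Proof. by move=> rs x [xr xJ]; split=> //; exact: le_trans rs. Qed.

(** The affine map which fixes the face J and multiplies the normal directions by r
   sends the unit piece onto the piece of radius r.  The exponent e is the
   dimension of the normal space; if it vanishes the only normal vector is 0 and
   the piece is contained in K. *)
Lemma piece_scaling J : J != finset.set0 ->
  exists e : nat, [/\ (e <= d)%N,
    forall r, 0 < r ->
      volume (piece J r) = ((r ^+ e)%:E * volume (piece J 1))%E &
    e = 0%N -> piece J 1 `<=` piece J 0].
Proof.
move=> /set0Pn[j0 j0J]; pose q := p j0.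
pose A : 'M[R]_(N, d) := \matrix_k (if k \in J then p k - q else 0).
have [m [M [md Mu LP]]] := orthogonal_scaling A.
pose s r : 'rV[R]_d := \row_(i < d) if (i < m)%N then 1 else r.
pose L r := invmx M *m diag_mx (s r) *m M.
have LA r y : hull J p y -> (y - q) *m L r = y - q.
  move=> [w [w0 w1] ->].
  have -> : \sum_(i in J) w i *: p i - q = (\row_i w i) *m A.
    rewrite -[q in LHS]scale1r -w1 scaler_suml -sumrB mulmx_sum_row.
    rewrite big_mkcond; apply: eq_bigr => i _; rewrite rowK mxE.
    by case: ifP => _; rewrite ?scaler0// scalerBr.
  by rewrite -mulmxA; have [-> _] := LP r.
have Lz r z : face z = J -> z *m L r = r *: z.
  move=> zJ; have [_ ->//] := LP r; move=> k; rewrite rowK.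
  case: ifP => [kJ|_]; last by rewrite -(scale0r (0 : 'rV_d)) dotpZr mul0r.
  by apply: (@face_orth _ _ _ p I); rewrite zJ.
exists (d - m)%N; split; first exact: leq_subr.
- move=> r r0.
  have s0 i : 0 < s r 0 i by rewrite mxE; case: ifP.
  have Lu : L r \in unitmx.
    rewrite !unitmx_mul unitmx_inv Mu andbT /= unitmxE det_diag unitfE.
    by apply/prodf_neq0 => i _; rewrite gt_eqF.
  have ps : \prod_i s r 0 i = r ^+ (d - m).
    rewrite (eq_bigr (fun i : 'I_d => if (i < m)%N then 1 else r)) => [|i _]; last by rewrite mxE.
    rewrite -(big_mkord predT (fun i => if (i < m)%N then 1 else r)).
    rewrite (@big_cat_nat _ _ _ m)//= !big_nat big1 ?mul1r => [|i /andP[_ ->]]//.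
    rewrite (eq_bigr (fun=> r)) => [|i /andP[mi _]]; last by rewrite ltnNge mi.
    by rewrite -big_nat prodr_const_nat.
  have E1 : piece J 1 = [set x | piece J r ((x - q) *m L r + q)].
    apply/seteqP; split=> x.
      move=> /pieceP[//|//|y [z [-> Jy zJ z1]]] /=.
      apply/pieceP => //; exists y, (r *: z); split=> //.
      - by rewrite addrAC mulmxDl LA// Lz// addrAC subrK.
      - by rewrite faceZ.
      - by rewrite enormZ gtr0_norm// ger_pMr.
    move=> /= /pieceP[//|//|y [z [xE Jy zJ zr]]].
    apply/pieceP => //; exists y, (r^-1 *: z); split=> //.
    - have := LA r _ Jy; have := Lz r _ zJ => hz hy.
      apply: (can_inj (subrK q)); apply: (can_inj (mulmxK Lu)).
      rewrite [in RHS]addrAC [RHS]mulmxDl hy -scalemxAl hz scalerA mulVf ?gt_eqF// scale1r.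
      by apply: (addIr q); rewrite xE addrAC subrK.
    - by rewrite faceZ// invr_gt0.
    - by rewrite enormZ gtr0_norm ?invr_gt0// mulrC ler_pdivrMr// mul1r.
  have mP : measurable (piece J r) by exact: measurable_piece.
  have -> : volume (piece J 1) = ((r ^+ (d - m))^-1%:E * volume (piece J r))%E.
    rewrite E1 (@volume_shift _ _ (- q) [set x | piece J r (x *m L r + q)]).
      rewrite -ps -(@volume_shift _ _ q _ mP).
      rewrite -(volume_conj_diag Mu s0 (A := [set v : 'rV_d | piece J r (v + q)])).
        by congr volume; apply/seteqP; split=> x /=; rewrite /L !mulmxA.
      exact: (measurable_preimage (measurable_shift q)).
    apply: (@measurable_preimage _ _ T T (fun x => (x : 'rV_d) *m L r + q)) => //.
    exact: (measurableT_comp (measurable_shift q) (measurable_mulmx (L r))).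
  by rewrite muleA -EFinM divff ?mul1e// expf_neq0// gt_eqF.
- move=> e0 x /pieceP[//|//|y [z [-> Jy zJ z1]]].
  apply/pieceP => //; exists y, z; split=> //.
  have dm : m = d by apply/eqP; rewrite eqn_leq md -subn_eq0 e0.
  have L1 : L 2 = 1%:M.
    rewrite /L (_ : diag_mx _ = 1%:M) ?mulmx1 ?mulVmx//.
    apply/matrixP => i j; rewrite !mxE dm ltn_ord.
    by case: eqP => // ->; rewrite eqxx.
  have := Lz 2 z zJ; rewrite L1 mulmx1 scaler_nat mulr2n => /eqP.
  rewrite -subr_eq0 opprD addrA subrr sub0r oppr_eq0 => /eqP ->.
  by rewrite /enorm -(scale0r (0 : 'rV_d)) dotpZr mul0r sqrtr0.
Qed.

(** For r = 0 and e > 0 the piece of radius 0 is contained in all the others, whose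
   volumes r^e v tend to 0. *)
Lemma piece_volume J : exists (e : nat) (v : R), (e <= d)%N /\
  forall r, 0 <= r -> volume (piece J r) = (r ^+ e * v)%:E.
Proof.
have [->|J0] := eqVneq J finset.set0.
  exists 0%N, 0; split=> // r r0; rewrite mulr0 (_ : piece _ _ = set0) ?volume0//.
  apply/seteqP; split=> // x /pieceP[//|//|y [z [_ [w [_ w1] _] _ _]]].
  by move: w1; rewrite big_set0 => /eqP; rewrite eq_sym oner_eq0.
have [e [ed pr p0]] := piece_scaling J0.
have mP r : measurable (piece J r) by exact: measurable_piece.
have vE : volume (piece J 1) = (fine (volume (piece J 1)))%:E.
  by rewrite (fine_volumeK (mP _) (@piece_bounded J 1)).
exists e, (fine (volume (piece J 1))); split=> // r; rewrite le_eqVlt.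
move=> /predU1P[<-|r0]; last by rewrite pr// {1}vE -EFinM.
have vE0 : volume (piece J 0) = (fine (volume (piece J 0)))%:E.
  by rewrite (fine_volumeK (mP _) (@piece_bounded J 0)).
move: pr p0; set v := fine _ => pr p0.
have [e0|e0] := posnP e.
  rewrite e0 expr0 mul1r -vE; congr volume; apply/seteqP; split; last exact: p0.
  exact: le_piece.
rewrite expr0n gtn_eqF// mul0r vE0; congr EFin; apply/eqP; rewrite eq_le.
set a := fine _; have a0 : 0 <= a by rewrite fine_ge0 ?volume_ge0.
rewrite a0 andbT leNgt; apply/negP => ap.
have v0 : 0 <= v by rewrite fine_ge0 ?volume_ge0.
have den : 0 < a + v by rewrite ltr_wpDr.
have den2 : 0 < a + v + a by rewrite addr_gt0.
(* a radius at most 1 for which t v < a *)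
pose t := a / (a + v + a).
have t0 : 0 < t by rewrite divr_gt0.
have t1 : t <= 1 by rewrite ler_pdivrMr // mul1r -addrA lerDl addr_ge0.
have : a <= t ^+ e * v.
  rewrite -lee_fin -vE0 EFinM -vE -pr//; apply: le_volume => //.
  exact/le_piece/ltW.
have : t ^+ e * v <= t * v.
  by rewrite ler_wpM2r// -[leRHS]expr1 ler_wiXn2l// ltW.
have : t * v < a.
  rewrite /t mulrAC ltr_pdivrMr // ltr_pM2l//; lra.
lra.
Qed.

End Steiner.

(** The pieces with the same exponent k together contribute the coefficient of r^k. *)
Lemma steiner_formula (R : realType) N d (I : {set 'I_N}) (p : 'I_N -> 'rV[R]_d) :
  I != finset.set0 -> exists V : nat -> R, is_intrinsic_volumes (hull I p) V.
Proof.
move=> I0.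
have [rho [rho_hull rho_le0]] := nearest_fun p I0.
have /choice[ev evP] : forall J, exists ev : nat * R, (ev.1 <= d)%N /\
    forall r, 0 <= r -> volume (piece p I rho J r) = (r ^+ ev.1 * ev.2)%:E.
  by move=> J; have [e [v h]] := piece_volume rho_hull rho_le0 J; exists (e, v).
pose c k : R := \sum_(J | (ev J).1 == k) (ev J).2.
exists (fun k => if (k <= d)%N then c (d - k)%N / ball_volume R (d - k) else 0).
split=> [k|r r0]; first by rewrite ltnNge => /negbTE ->.
rewrite (minkowski_ballE rho_hull rho_le0 r0).
rewrite -[volume _](@volume_measureE R d).
rewrite (measure_fin_partition _ (k := fun x : borel_space R d => face p I ((x : 'rV_d) - rho x))); last first.
  by move=> J; exact: (measurable_piece rho_hull rho_le0).
rewrite (eq_bigr (fun J => (r ^+ (ev J).1 * (ev J).2)%:E)); last first.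
  by move=> J _; rewrite -(evP J).2//; exact: volume_measureE.
rewrite sumEFin; congr EFin.
rewrite (eq_bigr (fun k : 'I_d.+1 => c (d - k)%N * r ^+ (d - k))); last first.
  move=> k _; rewrite -ltnS ltn_ord; congr (_ * _).
  by rewrite mulrC divfK// gt_eqF// ball_volume_gt0.
rewrite (reindex_inj rev_ord_inj)/=.
rewrite (eq_bigr (fun k : 'I_d.+1 => \sum_(J | (ev J).1 == k) r ^+ (ev J).1 * (ev J).2)); last first.
  move=> k _; rewrite subSS subKn -1?ltnS// /c mulr_suml.
  by apply: eq_bigr => J /eqP ->; rewrite mulrC.
rewrite (partition_big (fun J => inord (ev J).1 : 'I_d.+1) predT)//=.
apply: eq_bigr => k _; apply: eq_bigl => J.
rewrite -val_eqE/= inordK// ltnS; exact: (evP J).1.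
Qed.

(** * The surface measure of the sphere *)

Section SurfaceMeasure.
Context {R : realType} {d : nat}.
Local Notation T := (borel_space R d).
Implicit Types (A L : set T) (u v x : 'rV[R]_d) (s t : R).

(** At the origin, where there is no direction, the value is 0. *)
Definition dir x : 'rV[R]_d := (enorm x)^-1 *: x.

Lemma enorm_dir x : 0 < enorm x -> enorm (dir x) = 1.
Proof.
by move=> x0; rewrite enormZ gtr0_norm ?invr_gt0// mulVf// gt_eqF.
Qed.

Lemma dirK x : 0 < enorm x -> enorm x *: dir x = x.
Proof. by move=> x0; rewrite scalerA divff ?scale1r// gt_eqF. Qed.

Lemma dirZ t x : 0 < t -> dir (t *: x) = dir x.
Proof.
move=> t0; rewrite /dir enormZ gtr0_norm// scalerA invfM mulrAC mulVf ?mul1r//.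
by rewrite gt_eqF.
Qed.

Lemma dir_id u : esphere u -> dir u = u.
Proof. by rewrite /dir => ->; rewrite invr1 scale1r. Qed.

Lemma measurable_enormT : measurable_fun setT (fun x : T => enorm (x : 'rV_d)).
Proof. exact: (measurable_enorm (f := @id T)). Qed.

Lemma measurable_dir : measurable_fun setT (dir : T -> T).
Proof.
apply: measurable_coordP => i; under eq_fun do rewrite mxE.
apply: measurable_funM; last exact: measurable_coord.
under eq_fun do rewrite -powR_inv1 ?enorm_ge0//.
exact: (measurableT_comp (measurable_powR (-1)) measurable_enormT).
Qed.

Lemma measurable_lt_set disp (X : measurableType disp) (f g : X -> R) :
  measurable_fun setT f -> measurable_fun setT g ->
  measurable [set x | f x < g x].
Proof.
move=> mf mg; rewrite (_ : mkset _ = ~` [set x | g x <= f x]).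
  exact/measurableC/measurable_le_set.
by apply/seteqP; split=> x /=; rewrite ltNge => /negP.
Qed.

Definition sector L t : set T := [set x : 'rV_d | 0 < enorm x <= t /\ L (dir x)].

Lemma measurable_sector L t : measurable L -> measurable (sector L t).
Proof.
move=> mL; apply: measurableI; last exact: (measurable_preimage measurable_dir).
rewrite [X in measurable X](_ : _ = [set x : T | 0 < enorm (x : 'rV_d)] `&`
    [set x : T | enorm (x : 'rV_d) <= t]).
  apply: measurableI.
    by apply: measurable_lt_set; [exact: measurable_cst|exact: measurable_enormT].
  by apply: measurable_le_set; [exact: measurable_enormT|exact: measurable_cst].
by apply/seteqP; split=> x /= => [/andP[]//|[-> ->]].
Qed.

Lemma sector_bounded L t : sector L t `<=` @eball R d t.
Proof. by move=> x [/andP[]]. Qed.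

Lemma volume_sector L t : 0 < t -> measurable L ->
  volume (sector L t) = ((t ^+ d)%:E * volume (sector L 1))%E.
Proof.
move=> t0 mL.
have mS : measurable (sector L 1) by exact: measurable_sector.
have s0 i : 0 < (const_mx t^-1 : 'rV[R]_d) 0 i by rewrite mxE invr_gt0.
have := volume_conj_diag (unitmx1 R d) s0 mS.
rewrite (eq_bigr (fun=> t^-1)) => [|i _]; last by rewrite mxE.
rewrite prodr_const card_ord exprVn invrK => <-; congr volume.
apply/seteqP; split=> x /=; rewrite invmx1 !mulmx1 diag_const_mx mul_mx_scalar /sector/=;
  rewrite dirZ ?invr_gt0// enormZ gtr0_norm ?invr_gt0//;
  by rewrite pmulr_rgt0 ?invr_gt0// mulrC ler_pdivrMr// mul1r.
Qed.

Lemma surface_measure_sector A :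
  surface_measure A = (d%:R%:E * volume (sector A 1))%E.
Proof.
rewrite /surface_measure; congr (_ * volume _)%E; apply/seteqP; split=> v /=.
  move=> [r [u [/andP[r0 r1] Au Su ->]]].
  by rewrite /sector/= dirZ// dir_id// enormZ gtr0_norm// Su mulr1 r0.
move=> [/andP[v0 v1] Av]; exists (enorm v), (dir v); split=> //.
- by rewrite v0.
- exact: enorm_dir.
- by rewrite dirK.
Qed.

(** The surface measure is d times the image of the volume, restricted to the
   punctured unit ball, under the projection to the sphere. *)
Lemma surface_measureP :
  exists sigma : {measure set T -> \bar R},
    (sigma : set T -> \bar R) = @surface_measure R d.
Proof.
pose D := sector setT 1.
have mD : measurable D by apply: measurable_sector.
have [m mE] := pushforward_measureP (mrestr (volume_measure d) mD) measurable_dir.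
exists (mscale (@NngNum R d%:R (ler0n R d)) m).
apply/funext => A; rewrite surface_measure_sector /mscale.
congr (_ * _)%E.
transitivity (volume_measure d (dir @^-1` A `&` D)); first by rewrite mE.
rewrite volume_measureE; congr volume.
by apply/seteqP; split=> x => [[Ax [xn _]]|[xn Ax]].
Qed.

Lemma surface_measure_lty A : measurable A -> (surface_measure A < +oo)%E.
Proof.
move=> mA; rewrite surface_measure_sector lte_mul_pinfty ?lee_fin//.
exact: volume_bounded_lty (measurable_sector 1 mA) (@sector_bounded A 1).
Qed.

Lemma measurable_esphere : measurable (@esphere R d : set T).
Proof.
exact: (measurable_preimage (A := [set (1 : R)]) measurable_enormT (measurable_set1 1)).
Qed.

End SurfaceMeasure.

(** * Comparing polynomials near infinity *)

(** Coefficients are indexed from the leading one, as in Steiner's formula. *)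

Section PolynomialComparison.
Context {R : realType}.

Lemma leading_coef_ge0 m (a : nat -> R) (r0 : R) :
  (forall r, r0 <= r -> 0 <= \sum_(i < m.+1) a i * r ^+ (m - i)) -> 0 <= a 0%N.
Proof.
case: m => [|m] h.
  by have := h _ (lexx r0); rewrite big_ord1 expr0 mulr1.
rewrite leNgt; apply/negP => a0.
pose C := \sum_(i < m.+1) `|a i.+1|.
have C0 : 0 <= C by exact: sumr_ge0.
have na0 : 0 < - a 0%N by rewrite oppr_gt0.
have q0 : 0 <= C / - a 0%N by rewrite divr_ge0// ltW.
(* beyond C / - a 0 the leading term outweighs the others, bounded by C r^m *)
pose r := `|r0| + 1 + C / - a 0%N.
have r1 : 1 <= r.
  by rewrite /r addrAC lerDr addr_ge0.
have rp : 0 < r by exact: lt_le_trans r1.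
have r0r : r0 <= r.
  by apply: le_trans (ler_norm r0) _; rewrite /r -addrA lerDl addr_ge0.
have := h _ r0r; rewrite big_ord_recl subn0; apply/negP; rewrite -ltNge.
apply: (@le_lt_trans _ _ (r ^+ m * (a 0%N * r + C))).
  have -> : a 0%N * r ^+ m.+1 = r ^+ m * (a 0%N * r) by rewrite exprSr; ring.
  rewrite [leRHS]mulrDr lerD2l.
  rewrite mulrC /C mulr_suml; apply: ler_sum => i _.
  rewrite /= /bump leq0n add1n subSS; apply: le_trans (ler_norm _) _.
  by rewrite normrM ler_wpM2l// normrX gtr0_norm// ler_weXn2l// leq_subr.
rewrite pmulr_rlt0 ?exprn_gt0// /r mulrDr mulrCA.
rewrite invrN mulrN mulrN divff ?lt_eqF// mulr1 subrK.
by rewrite nmulr_rlt0// ltr_wpDl.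
Qed.

Lemma next_coef_ge0 m (a : nat -> R) (r0 : R) : a 0%N = 0 ->
  (forall r, r0 <= r -> 0 <= \sum_(i < m.+2) a i * r ^+ (m.+1 - i)) -> 0 <= a 1%N.
Proof.
move=> a0 h; apply: (@leading_coef_ge0 m (fun i => a i.+1) r0) => r /h.
rewrite big_ord_recl a0 mul0r add0r.
by under eq_bigr do rewrite /= /bump leq0n add1n subSS.
Qed.

Lemma sum_shifted_powers (J : finType) (v tau : J -> R) d r :
  \sum_j (r + tau j) ^+ d * v j =
  \sum_(i < d.+1) (\sum_j v j * tau j ^+ i *+ 'C(d, i)) * r ^+ (d - i).
Proof.
under [RHS]eq_bigr do rewrite mulr_suml.
rewrite exchange_big/=; apply: eq_bigr => j _.
rewrite exprDn mulr_suml; apply: eq_bigr => i _.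
by rewrite !mulrnAl; congr (_ *+ _); ring.
Qed.

(** As a polynomial in r, the sum of the v_j (r + tau_j)^d has the leading
   coefficients sum v_j and d sum tau_j v_j. *)
Lemma shifted_powers_le (J : finType) (v tau : J -> R) d (c : nat -> R) r0 :
  (forall r, r0 <= r -> \sum_j (r + tau j) ^+ d.+1 * v j <=
     \sum_(i < d.+2) c i * r ^+ (d.+1 - i)) ->
  \sum_j v j <= c 0%N /\
  (c 0%N = \sum_j v j -> d.+1%:R * \sum_j tau j * v j <= c 1%N).
Proof.
move=> h.
pose a i := c i - \sum_j v j * tau j ^+ i *+ 'C(d.+1, i).
have aE r : r0 <= r -> 0 <= \sum_(i < d.+2) a i * r ^+ (d.+1 - i).
  move=> /h; rewrite sum_shifted_powers -subr_ge0 -sumrB.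
  by under eq_bigr do rewrite -mulrBl.
have a0E : \sum_j v j * tau j ^+ 0 *+ 'C(d.+1, 0) = \sum_j v j.
  by apply: eq_bigr => j _; rewrite expr0 mulr1 bin0.
split; first by have := leading_coef_ge0 aE; rewrite /a a0E subr_ge0.
move=> c0; have := next_coef_ge0 _ aE; rewrite {1}/a a0E c0 subrr => /(_ erefl).
rewrite /a subr_ge0; apply: le_trans.
rewrite mulr_sumr le_eqVlt; apply/orP; left; apply/eqP/eq_bigr => j _.
by rewrite expr1 bin1 -[RHS]mulr_natl (mulrC (v j)).
Qed.

Lemma shifted_powers_ge (J : finType) (v tau : J -> R) d (c : nat -> R) r0 :
  (forall r, r0 <= r -> \sum_(i < d.+2) c i * r ^+ (d.+1 - i) <=
     \sum_j (r + tau j) ^+ d.+1 * v j) ->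
  c 0%N <= \sum_j v j /\
  (c 0%N = \sum_j v j -> c 1%N <= d.+1%:R * \sum_j tau j * v j).
Proof.
move=> h.
have [|h0 h1] := @shifted_powers_le J (fun j => - v j) tau d (fun i => - c i) r0.
  move=> r /h; rewrite -lerN2 -!sumrN => h'.
  under eq_bigr do rewrite mulrN; under [leRHS]eq_bigr do rewrite mulNr.
  exact: h'.
move: h0 h1; rewrite sumrN lerN2 => h0 h1; split=> // c0.
rewrite -lerN2 -mulrN -sumrN; under eq_bigr do rewrite -mulrN.
by apply: h1; rewrite c0.
Qed.

Lemma eq0_of_le_inv (a C : R) :
  (forall n, (0 < n)%N -> `|a| <= C / n%:R) -> a = 0.
Proof.
move=> h; apply/eqP; rewrite -normr_le0 leNgt; apply/negP => a0.
have C0 : 0 <= C by have := h 1%N isT; rewrite divr1; exact: le_trans.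
pose n := (Num.truncn (C / `|a|)).+1.
have := h n isT; rewrite ler_pdivlMr ?ltr0n// leNgt => /negP; apply.
rewrite mulrC -ltr_pdivrMr//.
have /andP[_] := truncn_itv (divr_ge0 C0 (normr_ge0 a)); exact.
Qed.

End PolynomialComparison.

(** * Parallel bodies and the support function *)

Lemma measurable_minkowski (R : realType) N d (I : {set 'I_N})
    (p : 'I_N -> 'rV[R]_d) r : I != finset.set0 -> 0 <= r ->
  measurable (minkowski_sum (hull I p) (@eball R d r) : set (borel_space R d)).
Proof.
move=> I0 r0; have [rho [rho_hull rho_le0]] := nearest_fun p I0.
rewrite (minkowski_ballE rho_hull rho_le0 r0).
apply: measurable_le_set; last exact: measurable_cst.
exact: measurable_enorm (measurable_disp rho_hull rho_le0).
Qed.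

(** The function h is the support function of the polytope, characterized by its
   two defining properties. *)
Section SupportFunction.
Context {R : realType} (N d : nat) (p : 'I_N -> 'rV[R]_d) (I : {set 'I_N}).
Variable h : 'rV[R]_d -> R.
Hypothesis h_ge : forall u i, i \in I -> dotp u (p i) <= h u.
Hypothesis h_vertex : forall u, exists2 i, i \in I & h u = dotp u (p i).
Local Notation T := (borel_space R d).
Implicit Types (u x y : 'rV[R]_d) (r s : R).

(** A bound for the norms of the points and for the support function on the
   sphere; the summand 1 makes it positive. *)
Definition hull_radius : R := 1 + \sum_i enorm (p i).
Local Notation M := hull_radius.

Lemma hull_radius_gt0 : 0 < M.
Proof. by rewrite ltr_pwDl// sumr_ge0// => i _; exact: enorm_ge0. Qed.

Lemma vertex_le_radius i : enorm (p i) <= M.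
Proof.
rewrite /hull_radius (bigD1 i)//= addrCA lerDl addr_ge0// sumr_ge0// => j _.
exact: enorm_ge0.
Qed.

Lemma support_norm_le u : esphere u -> `|h u| <= M.
Proof.
move=> Su; have [i iI ->] := h_vertex u.
rewrite ler_norml lerNl -dotpNl; apply/andP; split.
  apply: le_trans (dotp_le_enorm _ _) _.
  by rewrite -scaleN1r enormZ normrN1 mul1r Su mul1r vertex_le_radius.
apply: le_trans (dotp_le_enorm _ _) _.
by rewrite Su mul1r vertex_le_radius.
Qed.

Lemma dist_vertexE x i : 0 < enorm x -> h (dir x) = dotp (dir x) (p i) ->
  dotp (x - p i) (x - p i) =
  (enorm x - h (dir x)) ^+ 2 + enorm (p i) ^+ 2 - h (dir x) ^+ 2.
Proof.
move=> x0 hx; rewrite dotpBl !dotpBr (dotpC (p i)) -!sqr_enorm.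
rewrite -{2 3}(dirK x0) dotpZl -hx; ring.
Qed.

(** If |x| <= r + h(u) - s, then x is within distance r of the vertex maximizing the
   direction u of x, as the squared distance exceeds (|x| - h(u))^2 by at most
   M^2. *)
Lemma minkowski_lower s r x : 0 < s -> M + s <= r -> s ^+ 2 + M ^+ 2 <= 2 * r * s ->
  0 < enorm x -> enorm x <= r + h (dir x) - s ->
  minkowski_sum (hull I p) (@eball R d r) x.
Proof.
move=> s0 rMs r2 x0 xr; have [i iI hx] := h_vertex (dir x).
have r0 : 0 <= r by apply: le_trans rMs; rewrite addr_ge0 ?ltW ?hull_radius_gt0.
exists (p i); first exact: hull_vertex.
exists (x - p i); last by rewrite addrC subrK.
rewrite /eball/= enorm_le// (dist_vertexE x0 hx).
have hM : h (dir x) <= M.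
  exact: le_trans (ler_norm _) (support_norm_le (enorm_dir x0)).
have : (enorm x - h (dir x)) ^+ 2 <= (r - s) ^+ 2.
  rewrite -[leLHS]real_normK ?num_real// ler_sqr ?nnegrE//; last first.
    by have := hull_radius_gt0; lra.
  rewrite ler_norml; apply/andP; split; [|lra].
  by move: (ltW x0) => ?; lra.
have : enorm (p i) ^+ 2 <= M ^+ 2.
  by rewrite ler_sqr ?nnegrE ?enorm_ge0 ?vertex_le_radius// ltW// hull_radius_gt0.
have := sqr_ge0 (h (dir x)); rewrite [(r - s) ^+ 2]sqrrB; lra.
Qed.

(** A point k of the hull within distance r of x satisfies <u, k> <= h(u), whence
   (|x| - h(u))^2 <= r^2 + M^2. *)
Lemma minkowski_upper s r x : 0 < s -> 0 <= r -> M ^+ 2 <= 2 * r * s ->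
  0 < enorm x -> minkowski_sum (hull I p) (@eball R d r) x ->
  enorm x <= r + s + h (dir x).
Proof.
move=> s0 r0 r2 x0 [k Kk [b br xE]].
have {br} : dotp (x - k) (x - k) <= r ^+ 2.
  by rewrite -enorm_le// -xE addrC addKr.
have kh : dotp (dir x) k <= h (dir x).
  by apply: hull_dotp_le Kk _ => i iI; exact: h_ge.
rewrite dotpBl !dotpBr (dotpC k x) -[dotp x x]sqr_enorm -{2 3}(dirK x0) dotpZl => xk.
have k0 := dotp_ge0 k.
have : enorm x * dotp (dir x) k <= enorm x * h (dir x) by rewrite ler_pM2l.
move=> xkh; have hM : h (dir x) ^+ 2 <= M ^+ 2.
  rewrite -[leLHS]real_normK ?num_real// ler_sqr ?nnegrE ?(ltW hull_radius_gt0)//.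
  exact/support_norm_le/enorm_dir.
have : (enorm x - h (dir x)) ^+ 2 <= (r + s) ^+ 2.
  rewrite sqrrB sqrrD; have := sqr_ge0 s; lra.
rewrite -[leLHS]real_normK ?num_real// ler_sqr ?nnegrE ?addr_ge0 ?(ltW s0)//.
by move=> /(le_trans (ler_norm _)); rewrite lerBlDr.
Qed.

End SupportFunction.

(** * The first intrinsic volume *)

(* On a successor dimension, simplification would unfold the recursion. *)
#[local] Arguments volume : simpl never.

Lemma volume_fin_partition (R : realType) d (I : finType)
    (k : borel_space R d -> I) (D : set (borel_space R d)) :
  (forall i, measurable (D `&` [set x | k x = i])) ->
  volume D = (\sum_i volume (D `&` [set x | k x = i]))%E.
Proof.
move=> mk; rewrite -[volume D]volume_measureE.
have := measure_fin_partition (volume_measure d) mk.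
by move=> /= ->; apply: eq_bigr => i _; exact: volume_measureE.
Qed.

Lemma volume_origin (R : realType) d :
  volume [set (0 : 'rV[R]_d.+1)] = 0%E.
Proof.
have := @volume_box R d.+1 (fun=> 0) (fun=> 0) (fun=> lexx 0).
rewrite big_ord_recl subrr mul0r => vb; rewrite -[RHS]vb; congr volume.
apply/seteqP; split=> v /= => [-> i|h]; first by rewrite mxE lexx.
by apply/rowP => i; apply/eqP; rewrite mxE eq_le andbC h.
Qed.

Lemma measurable_punctured (R : realType) d :
  measurable [set x : borel_space R d | 0 < enorm (x : 'rV_d)].
Proof.
by apply: measurable_lt_set; [exact: measurable_cst|exact: measurable_enormT].
Qed.

Lemma volume_punctured (R : realType) d (A : set (borel_space R d.+1)) :
  measurable A -> volume A = volume (A `&` [set x : 'rV_d.+1 | 0 < enorm x]).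
Proof.
move=> mA.
have mp := @measurable_punctured R d.+1.
rewrite (volume_fin_partition (k := fun x : borel_space R d.+1 => 0 < enorm (x : 'rV_d.+1))).
  rewrite big_bool /= [X in (_ + X)%E](_ : _ = 0%E) ?adde0//.
  apply/eqP; rewrite eq_le volume_ge0 andbT -(volume_origin R d).
  apply: le_volume.
  - apply: measurableI => //.
    rewrite [X in measurable X](_ : _ = ~` [set x : 'rV_d.+1 | 0 < enorm x]).
      exact: measurableC.
    by apply/seteqP; split=> x /= => [->|/negP/negbTE].
  - rewrite [X in measurable X](_ : _ = [set v : 'rV_d.+1 | forall i, 0 <= v 0 i <= 0]).
      exact: (measurable_box (fun=> 0) (fun=> 0)).
    apply/seteqP; split=> v /= => [-> i|h]; first by rewrite mxE lexx.
    by apply/rowP => i; apply/eqP; rewrite mxE eq_le andbC h.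
  - move=> x [_ /= x0]; apply/enorm0_eq0/eqP; rewrite eq_le enorm_ge0 andbT.
    by rewrite leNgt x0.
case; apply: measurableI => //.
rewrite [X in measurable X](_ : _ = ~` [set x : 'rV_d.+1 | 0 < enorm x]).
  exact: measurableC.
by apply/seteqP; split=> x /= => [->|/negP/negbTE].
Qed.

Lemma integrable_sphere (R : realType) d
    (sigma : {measure set (borel_space R d) -> \bar R}) (h : 'rV[R]_d -> R) (C : R) :
  (sigma : set _ -> \bar R) = @surface_measure R d ->
  measurable_fun setT (h : borel_space R d -> R) ->
  (forall u, esphere u -> `|h u| <= C) ->
  sigma.-integrable (@esphere R d) (EFin \o h).
Proof.
move=> sigmaE mh hC; have mS := @measurable_esphere R d.
apply: measurable_bounded_integrable => //.
- by rewrite sigmaE surface_measure_lty.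
- exact: measurable_funTS.
- exists C; split; first exact: num_real.
  by move=> y Cy u Su; apply: le_trans (hC u Su) (ltW Cy).
Qed.

(** The sphere is sliced by the levels of h + M, which takes its values in
   [0, 2 M], at the multiples of delta = M / n. *)
Section Levels.
Context {R : realType} (N d' : nat) (p : 'I_N -> 'rV[R]_d'.+1) (I : {set 'I_N}).
Local Notation d := d'.+1.
Variable h : 'rV[R]_d -> R.
Hypothesis I0 : I != finset.set0.
Hypothesis h_ge : forall u i, i \in I -> dotp u (p i) <= h u.
Hypothesis h_vertex : forall u, exists2 i, i \in I & h u = dotp u (p i).
Local Notation T := (borel_space R d).
Hypothesis mh : measurable_fun setT (h : T -> R).
Local Notation M := (hull_radius p).
Variable n : nat.
Hypothesis n0 : (0 < n)%N.
Implicit Types (u x y : 'rV[R]_d) (r s t : R) (j : 'I_(2 * n).+1).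

Let delta : R := M / n%:R.

Let delta_gt0 : 0 < delta.
Proof. by rewrite divr_gt0 ?hull_radius_gt0// ltr0n. Qed.

Let nat_level u : nat := Num.truncn ((h u + M) / delta).

Let level u : 'I_(2 * n).+1 := inord (nat_level u).

Let slice (j : nat) : set T :=
  [set u : 'rV_d | j%:R * delta <= h u + M < j.+1%:R * delta].

Let measurable_slice (k : nat) : measurable (slice k).
Proof.
have mhM : measurable_fun setT (fun u : T => h u + M).
  by apply: measurable_funD => //; exact: measurable_cst.
rewrite (_ : slice k = [set u : T | k%:R * delta <= h u + M] `&`
    [set u : T | h u + M < k.+1%:R * delta]).
  apply: measurableI; first by apply: measurable_le_set => //; exact: measurable_cst.
  by apply: measurable_lt_set => //; exact: measurable_cst.
by apply/seteqP; split=> u /= => [/andP[]//|[? ?]]; apply/andP.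
Qed.

Let levelP u j : esphere u -> (level u = j) <-> slice j u.
Proof.
move=> Su; have := support_norm_le h_vertex Su; rewrite ler_norml => /andP[h1 h2].
have y0 : 0 <= (h u + M) / delta by rewrite divr_ge0 ?(ltW delta_gt0)// -lerBlDr sub0r.
have y2 : (nat_level u < (2 * n).+1)%N.
  have /andP[+ _] := truncn_itv y0.
  rewrite ltnS -(ler_nat R) => /le_trans; apply.
  have n0' : n%:R != 0 :> R by rewrite pnatr_eq0 -lt0n.
  have -> : (2 * n)%:R = (M + M) / delta.
    have M0 : M != 0 by rewrite gt_eqF// hull_radius_gt0.
    by rewrite /delta natrM; field; apply/andP.
  by rewrite ler_pM2r ?invr_gt0// lerD2r.
have sE : slice j u <-> nat_level u = j.
  rewrite /slice/= -ler_pdivlMr// -ltr_pdivrMr//.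
  split=> [/truncn_def//|<-]; exact: truncn_itv.
split=> [lj|/sE lj].
  by apply/sE; rewrite -lj /level inordK.
by apply/val_inj; rewrite /= /level inordK.
Qed.

Let weight j : R := fine (volume (sector (slice j) 1)).

Let volume_slice j t : 0 < t -> volume (sector (slice j) t) = (t ^+ d * weight j)%:E.
Proof.
move=> t0; rewrite volume_sector// EFinM (fine_volumeK (r := 1))//.
  exact: measurable_sector.
exact: sector_bounded.
Qed.

Let slicing (D : set T) : measurable D -> D `<=` [set x : 'rV_d | 0 < enorm x] ->
  volume D = (\sum_(j < (2 * n).+1) volume (D `&` [set x : 'rV_d | slice j (dir x)]))%E.
Proof.
move=> mD D0.
have DE (j : 'I_(2 * n).+1) : D `&` [set x : T | level (dir (x : 'rV_d)) = j] = D `&` [set x : 'rV_d | slice j (dir x)].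
  apply/seteqP; split=> x [Dx xj]; split=> //; apply/levelP => //;
  exact/enorm_dir/D0.
rewrite (volume_fin_partition (k := fun x : T => level (dir (x : 'rV_d)))).
  by apply: eq_bigr => j _; rewrite -DE.
move=> j; rewrite DE; apply: measurableI => //.
exact: (measurable_preimage measurable_dir (measurable_slice j)).
Qed.

Let sum_weight : \sum_j weight j = ball_volume R d.
Proof.
have mB : measurable (@eball R d 1 : set T) by exact: measurable_eball.
apply: EFin_inj; rewrite /ball_volume (fine_volumeK mB (@subset_refl _ _)).
rewrite (volume_punctured mB) slicing; last 2 first.
- by apply: measurableI => //; exact: measurable_punctured.
- by move=> x [].
  rewrite -sumEFin; apply: eq_bigr => j _.
  rewrite -[weight j]mul1r -[X in X * _](expr1n R d) -volume_slice//.
  congr volume; apply/seteqP; split=> x /=.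
    by move=> [/andP[x0 xB] xj].
  by move=> [[xB x0] xj]; split=> //; apply/andP.
Qed.

(** Beyond this radius the errors of [minkowski_lower] and [minkowski_upper] are at
   most delta. *)
Let threshold : R := M + 2 * delta + (delta ^+ 2 + M ^+ 2) / delta.

Let thresholdP r : threshold <= r -> [/\ M + 2 * delta <= r &
  delta ^+ 2 + M ^+ 2 <= 2 * r * delta].
Proof.
move=> rt; have M0 := hull_radius_gt0 p.
have q0 : 0 <= (delta ^+ 2 + M ^+ 2) / delta.
  by rewrite divr_ge0 ?(ltW delta_gt0)// addr_ge0// sqr_ge0.
have r1 : M + 2 * delta <= r by apply: le_trans rt; rewrite lerDl.
split=> //; have r2 : (delta ^+ 2 + M ^+ 2) / delta <= r.
  by apply: le_trans rt; rewrite lerDr addr_ge0 ?mulr_ge0// ltW.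
rewrite ler_pdivrMr// in r2; apply: le_trans r2 _.
rewrite -mulrA mulr_natl mulr2n lerDl mulr_ge0 ?(ltW delta_gt0)//.
by apply: le_trans r1; rewrite addr_ge0 ?mulr_ge0// ltW.
Qed.

Variable V : nat -> R.
Hypothesis steinerV : is_intrinsic_volumes (hull I p) V.

Let coef (i : nat) : R := ball_volume R (d - i) * V i.

Let body r : set T := minkowski_sum (hull I p) (@eball R d r) `&`
  [set x : 'rV_d | 0 < enorm x].

Let measurable_body r : 0 <= r -> measurable (body r).
Proof.
move=> r0; apply: measurableI; first exact: measurable_minkowski.
exact: measurable_punctured.
Qed.

Let volume_body r : 0 <= r ->
  (\sum_(j < (2 * n).+1) volume (body r `&` [set x : 'rV_d | slice j (dir x)]))%E =
  (\sum_(i < d.+1) coef i * r ^+ (d - i))%:E.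
Proof.
move=> r0; rewrite -slicing; [|exact: measurable_body|by move=> x []].
rewrite -volume_punctured; last exact: measurable_minkowski.
by have [_ ->] := steinerV.
Qed.

Let measurable_body_slice r j : 0 <= r ->
  measurable (body r `&` [set x : 'rV_d | slice j (dir x)]).
Proof.
move=> r0; apply: measurableI; first exact: measurable_body.
exact: (measurable_preimage measurable_dir (measurable_slice j)).
Qed.

Let lower_sum r : threshold <= r ->
  \sum_(j < (2 * n).+1) (r + (j%:R * delta - M - delta)) ^+ d * weight j <=
  \sum_(i < d.+1) coef i * r ^+ (d - i).
Proof.
move=> /thresholdP[r1 r2]; have M0 := hull_radius_gt0 p.
have r0 : 0 <= r by apply: le_trans r1; rewrite addr_ge0 ?mulr_ge0// ltW.
rewrite -lee_fin -volume_body// -sumEFin; apply: lee_sum => j _.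
have jd : 0 <= j%:R * delta by rewrite mulr_ge0// ltW.
rewrite -volume_slice; last by have := delta_gt0; lra.
apply: le_volume; [exact: measurable_sector|exact: measurable_body_slice|].
move=> x [/andP[x0 xr] xs]; split; last exact: xs.
case/andP: xs => xj _.
split=> //; apply: (minkowski_lower h_vertex delta_gt0) => //.
  by have := delta_gt0; lra.
by move: xr xj; lra.
Qed.

Let upper_sum r : threshold <= r ->
  \sum_(i < d.+1) coef i * r ^+ (d - i) <=
  \sum_(j < (2 * n).+1) (r + (j%:R * delta - M + 2 * delta)) ^+ d * weight j.
Proof.
move=> /thresholdP[r1 r2]; have M0 := hull_radius_gt0 p.
have r0 : 0 <= r by apply: le_trans r1; rewrite addr_ge0 ?mulr_ge0// ltW.
rewrite -lee_fin -volume_body// -sumEFin; apply: lee_sum => j _.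
have jd : 0 <= j%:R * delta by rewrite mulr_ge0// ltW.
rewrite -volume_slice; last by have := delta_gt0; lra.
apply: le_volume; [exact: measurable_body_slice|exact: measurable_sector|].
move=> x [[Kx x0] xj]; split=> //; apply/andP; split=> //.
have r3 : M ^+ 2 <= 2 * r * delta by have := sqr_ge0 delta; lra.
have := minkowski_upper h_ge h_vertex delta_gt0 r0 r3 x0 Kx.
move: xj; rewrite /slice/= => /andP[_].
by rewrite -natr1 mulrDl mul1r; lra.
Qed.

Let level_sum : R := d%:R * \sum_(j < (2 * n).+1) j%:R * delta * weight j.

(** Both sums have the volume of the ball as leading coefficient, so that the next
   coefficients compare. *)
Let coef_bounds :
  level_sum - (M + delta) * (d%:R * ball_volume R d) <= coef 1 /\
  coef 1 <= level_sum + (2 * delta - M) * (d%:R * ball_volume R d).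
Proof.
have [l0 l1] := shifted_powers_le lower_sum.
have [u0 u1] := shifted_powers_ge upper_sum.
have c0 : coef 0 = \sum_j weight j by apply/eqP; rewrite eq_le l0 u0.
have := l1 c0; have := u1 c0.
have lin c : d%:R * \sum_(j < (2 * n).+1) (j%:R * delta + c) * weight j =
    level_sum + c * (d%:R * ball_volume R d).
  rewrite /level_sum -sum_weight; under eq_bigr do rewrite mulrDl.
  by rewrite big_split/= -mulr_sumr; ring.
under eq_bigr do rewrite -addrA; rewrite lin => ?.
under eq_bigr do rewrite -addrA; rewrite lin => ?.
split; lra.
Qed.

Let area : R := d%:R * ball_volume R d.

Let surface_slice j : surface_measure (@esphere R d `&` slice j) = (d%:R * weight j)%:E.
Proof.
rewrite surface_measure_sector EFinM; congr (_ * _)%E.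
rewrite -[weight j]mul1r -[X in X * _](expr1n R d) -volume_slice//.
congr volume; apply/seteqP; split=> x /= [xn]; first by move=> [].
by move=> xj; split=> //; split=> //; apply: enorm_dir; case/andP: xn.
Qed.

Let surface_sphere : surface_measure (@esphere R d) = area%:E.
Proof.
have mB : measurable (@eball R d 1 : set T) by exact: measurable_eball.
rewrite surface_measure_sector EFinM; congr (_ * _)%E.
rewrite /ball_volume (fine_volumeK mB (@subset_refl _ _)) (volume_punctured mB).
congr volume; apply/seteqP; split=> x /=.
  by move=> [/andP[x0 xB] _].
by move=> [xB x0]; split; [apply/andP|exact: enorm_dir].
Qed.

Let step (c : nat -> R) u : R :=
  \sum_(j < (2 * n).+1) c j * \1_(slice j : set T) u.

Let stepE c u : esphere u -> exists2 j, slice j u & step c u = c j.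
Proof.
move=> Su; have uj : slice (level u) u by apply/levelP.
exists (level u) => //; rewrite /step (bigD1 (level u))//= indicE mem_set// mulr1.
rewrite big1 ?addr0// => i il; rewrite indicE memNset ?mulr0// => /(levelP _ Su) li.
by rewrite li eqxx in il.
Qed.

Let integral_step (sigma : {measure set T -> \bar R}) (c : nat -> R) :
  (sigma : set T -> \bar R) = @surface_measure R d -> (forall j : nat, 0 <= c j) ->
  (\int[sigma]_(u in @esphere R d) (step c u)%:E)%E =
  (d%:R * \sum_(j < (2 * n).+1) c j * weight j)%:E.
Proof.
move=> sigmaE c0.
have mS := @measurable_esphere R d.
have m1 (j : nat) : measurable_fun (@esphere R d : set T) (fun u : T => c j * \1_(slice j) u).
  by apply: measurable_funM; [exact: measurable_cst|apply: measurable_indic; exact: measurable_slice].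
under eq_integral do rewrite /step -sumEFin.
rewrite ge0_integral_sum//; last 2 first.
- by move=> j; apply/measurable_EFinP; exact: m1.
- by move=> j u _; rewrite lee_fin mulr_ge0// indicE.
rewrite mulr_sumr -sumEFin; apply: eq_bigr => j _.
have -> := @integralZl_indic _ _ R sigma (@esphere R d) mS (fun=> slice j) (c j).
- rewrite integral_indic// sigmaE setIC surface_slice -EFinM; congr EFin; ring.
- by move=> cj; move: (c0 j); rewrite leNgt cj.
- by [].
Qed.

(** The integral of h satisfies the same bounds as the coefficient, being squeezed
   between the integrals of two functions which are constant on the slices. *)
Lemma support_integral_bounds (H : R) :
  (\int[@surface_measure R d]_(u in @esphere R d) (h u)%:E)%E = H%:E ->
  `|coef 1 - H| <= (2 * M * area) / n%:R.
Proof.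
have [sigma sigmaE] := @surface_measureP R d; rewrite -sigmaE => hH.
have mS := @measurable_esphere R d.
have mhM : measurable_fun (@esphere R d : set T) (fun u : T => h u + M).
  by apply: measurable_funTS; apply: measurable_funD => //; exact: measurable_cst.
have hM u : esphere u -> 0 <= h u + M.
  move=> /(support_norm_le h_vertex); rewrite ler_norml => /andP[+ _].
  by rewrite -lerBlDr sub0r.
have X : (\int[sigma]_(u in @esphere R d) (h u + M)%:E = (H + M * area)%:E)%E.
  have := @integralD_EFin _ _ R sigma _ mS h (cst M).
  rewrite /= => ->.
  - by rewrite hH integral_cst// sigmaE surface_sphere.
  - exact: (integrable_sphere sigmaE mh (support_norm_le h_vertex)).
  - apply: (integrable_sphere (h := cst M) (C := `|M|) sigmaE) => //.
have mstep c : measurable_fun (@esphere R d : set T) (EFin \o step c).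
  apply/measurable_EFinP; apply: measurable_sum => j.
  by apply: measurable_funM; [exact: measurable_cst|apply: measurable_indic; exact: measurable_slice].
have mhME : measurable_fun (@esphere R d : set T) (fun u : T => (h u + M)%:E).
  exact/measurable_EFinP.
have lo : d%:R * (\sum_(j < (2 * n).+1) j%:R * delta * weight j) <= H + M * area.
  have c0 (j : nat) : 0 <= j%:R * delta by rewrite mulr_ge0// ltW.
  rewrite -lee_fin -X -(integral_step sigmaE c0); apply: ge0_le_integral;
    [exact: mS| |exact: mstep|exact: mhME|].
    by move=> u Su; have [j _ ->] := stepE (fun k : nat => k%:R * delta) Su; rewrite lee_fin.
  move=> u Su; have [j /andP[uj _] ->] := stepE (fun k : nat => k%:R * delta) Su.
  by rewrite lee_fin.
have hi : H + M * area <= d%:R * (\sum_(j < (2 * n).+1) j.+1%:R * delta * weight j).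
  have c0 (j : nat) : 0 <= j.+1%:R * delta by rewrite mulr_ge0// ltW.
  rewrite -lee_fin -X -(integral_step sigmaE c0); apply: ge0_le_integral;
    [exact: mS| |exact: mhME|exact: mstep|].
    by move=> u Su; rewrite lee_fin hM.
  move=> u Su; have [j /andP[_ uj] ->] := stepE (fun k : nat => k.+1%:R * delta) Su.
  by rewrite lee_fin ltW.
have hiE : d%:R * (\sum_(j < (2 * n).+1) j.+1%:R * delta * weight j) =
    level_sum + delta * area.
  rewrite /level_sum /area -sum_weight (eq_bigr (fun j : 'I_(2 * n).+1 =>
    j%:R * delta * weight j + delta * weight j)); last first.
    by move=> j _; rewrite -natr1; ring.
  by rewrite big_split/= -mulr_sumr; ring.
have dE : 2 * M * area / n%:R = 2 * (delta * area) by rewrite /delta; ring.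
have [b1 b2] := coef_bounds.
move: lo hi b1 b2; rewrite hiE -/level_sum -/area dE => lo hi b1 b2.
have da : (M + delta) * area = M * area + delta * area by ring.
have db : (2 * delta - M) * area = 2 * (delta * area) - M * area by ring.
rewrite da in b1; rewrite db in b2.
rewrite ler_norml; apply/andP; split; lra.
Qed.

End Levels.

(** The mean width formula: the two sides differ by O(1 / n) for every n. *)
Lemma intrinsic_volume1_support (R : realType) N d (p : 'I_N -> 'rV[R]_d.+1)
    (I : {set 'I_N}) (h : 'rV[R]_d.+1 -> R) (V : nat -> R) :
  I != finset.set0 ->
  (forall u i, i \in I -> dotp u (p i) <= h u) ->
  (forall u, exists2 i, i \in I & h u = dotp u (p i)) ->
  measurable_fun setT (h : borel_space R d.+1 -> R) ->
  is_intrinsic_volumes (hull I p) V ->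
  (\int[@surface_measure R d.+1]_(u in @esphere R d.+1) (h u)%:E)%E =
  (ball_volume R d * V 1%N)%:E.
Proof.
move=> I0 h_ge h_vertex mh steinerV.
have [sigma sigmaE] := @surface_measureP R d.+1.
have ih := integrable_sphere sigmaE mh (support_norm_le h_vertex).
have mS := @measurable_esphere R d.+1.
have hH := fineK (integrable_fin_num mS ih).
rewrite sigmaE in hH; rewrite -hH; congr EFin.
apply/eqP; rewrite eq_sym -subr_eq0; apply/eqP.
apply: (@eq0_of_le_inv _ _ (2 * hull_radius p * (d.+1%:R * ball_volume R d.+1))) => n n0.
have := support_integral_bounds I0 h_ge h_vertex mh n0 steinerV (esym hH).
by rewrite subSS subn0.
Qed.

(** * Coefficients on the unions of generators *)

Section UnionCoefficients.
Variable N : nat.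
Implicit Types (S T J : {set 'I_N}) (f g : free_boolean N) (h : {set 'I_N} -> int).

Definition meets T J : bool := (T :&: J)%SET != finset.set0.

(** Equality is only asked on nonempty sets since no union of generators contains the
   empty assignment. *)
Definition union_span h : Prop :=
  exists m : {ffun {set 'I_N} -> int}, m finset.set0 = 0 /\
    forall T, T != finset.set0 ->
      h T = \sum_(J : {set 'I_N} | J != finset.set0) m J * (meets T J)%:R.

Lemma union_span_eq h h' :
  (forall T, T != finset.set0 -> h T = h' T) -> union_span h -> union_span h'.
Proof. by move=> hh' [m [m0 mE]]; exists m; split=> // T T0; rewrite -hh'// mE. Qed.

Lemma union_span0 : union_span (fun=> 0).
Proof.
by exists [ffun=> 0]; split=> [|T _]; rewrite ?ffunE// big1// => J _; rewrite ffunE mul0r.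
Qed.

Lemma union_spanB h h' : union_span h -> union_span h' ->
  union_span (fun T => h T - h' T).
Proof.
move=> [m [m0 mE]] [m' [m'0 m'E]]; exists [ffun J => m J - m' J]; split=> [|T T0].
  by rewrite ffunE m0 m'0 subrr.
rewrite mE// m'E// -sumrB; apply: eq_bigr => J _.
by rewrite ffunE mulrBl.
Qed.

Lemma union_span_sum (I : finType) (P : pred I) (F : I -> {set 'I_N} -> int) :
  (forall i, P i -> union_span (F i)) ->
  union_span (fun T => \sum_(i | P i) F i T).
Proof.
move=> FP; elim: (index_enum I) => [|i r IH].
  by apply: union_span_eq union_span0 => T _; rewrite big_nil.
case Pi: (P i); last by apply: union_span_eq IH => T _; rewrite big_cons Pi.
apply: union_span_eq (union_spanB (FP i Pi) (union_spanB union_span0 IH)) => T _.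
by rewrite big_cons Pi sub0r opprK.
Qed.

Lemma union_span_meets J : union_span (fun T => (meets T J)%:R).
Proof.
have [->|J0] := eqVneq J finset.set0.
  apply: union_span_eq union_span0 => T _.
  by rewrite /meets finset.setI0 eqxx.
exists [ffun K => (K == J)%:R]; split=> [|T T0].
  by rewrite ffunE eq_sym (negbTE J0).
rewrite (bigD1 J)//= ffunE eqxx mul1r big1 ?addr0// => K /andP[_ KJ].
by rewrite ffunE (negbTE KJ) mul0r.
Qed.

Lemma meets_setT T : T != finset.set0 -> meets T finset.setT.
Proof. by rewrite /meets finset.setIT. Qed.

Lemma meets_setC T S : meets T (~: S)%SET = ~~ (T \subset S).
Proof. by rewrite /meets finset.setI_eq0 finset.disjoints_subset finset.setCK. Qed.

Lemma union_span_subset S : union_span (fun T => (T \subset S)%:R).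
Proof.
apply: union_span_eq (union_spanB (union_span_meets finset.setT) (union_span_meets (~: S)%SET)) => T T0.
by rewrite meets_setT// meets_setC; case: (T \subset S).
Qed.

(** The indicator of S is that of the subsets of S minus those of the proper
   subsets, which are combinations by induction on the size. *)
Lemma union_span_atom S : union_span (fun T => (T == S)%:R).
Proof.
elim: {S}#|S| {-2}S (leqnn #|S|) => [|k IH] S cS.
  move: cS; rewrite leqn0 cards_eq0 => /eqP ->.
  by apply: union_span_eq union_span0 => T /negbTE ->.
have prop_span : union_span (fun T => \sum_(S' : {set 'I_N} | S' \proper S) (T == S')%:R).
  by apply: union_span_sum => S' /proper_card S'S; apply: IH; rewrite -ltnS (leq_trans S'S).
apply: union_span_eq (union_spanB (union_span_subset S) prop_span) => T _.
have [->|TS] := eqVneq T S.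
  rewrite subxx big1 ?subr0// => S'; rewrite properE => /andP[_ SS'].
  by case: eqP => // SE; rewrite SE subxx in SS'.
have [TS'|TS'] := boolP (T \subset S).
  rewrite (bigD1 T)/=; last by rewrite finset.properEneq TS.
  rewrite eqxx big1 ?addr0 ?subrr// => S' /andP[_ /negbTE].
  by rewrite eq_sym => ->.
rewrite big1 ?subrr// => S' /proper_sub S'S.
by case: eqP => // TE; rewrite TE S'S in TS'.
Qed.

Lemma union_span_mem f : finset.set0 \notin f -> union_span (fun T => (T \in f)%:R).
Proof.
move=> f0.
have : union_span (fun T => \sum_(S : {set 'I_N} | S \in f) (T == S)%:R).
  by apply: union_span_sum => S _; exact: union_span_atom.
apply: union_span_eq => T _; have [Tf|Tf] := boolP (T \in f).
  rewrite (bigD1 T)//= eqxx big1 ?addr0// => S /andP[_ /negbTE].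
  by rewrite eq_sym => ->.
by rewrite big1// => S Sf; case: eqP => // TS; rewrite TS Sf in Tf.
Qed.

(** Atoms belong to the class: intersect or subtract the generators one after
   the other, starting from a generator of the atom. *)
Lemma difference_class_atom S : S != finset.set0 -> difference_class [set S]%SET.
Proof.
move=> /set0Pn[i0 i0S].
pose F (s : seq 'I_N) := foldr (fun i f => if i \in S then (f :&: generator i)%SET
  else (f :\: generator i)%SET) (generator i0) s.
have FC s : difference_class (F s).
  elim: s => [|i s IH] /=; first exact: DGen.
  by case: ifP => _; [apply: DCap|apply: DDiff] => //; exact: DGen.
have FE s T : (T \in F s) = (i0 \in T) && all (fun i => (i \in T) == (i \in S)) s.
  elim: s => [|i s IH] /=; first by rewrite inE andbT.
  by case: ifP => iS; rewrite !inE IH ?eqbF_neg ?eqb_id; do 2 case: (_ \in T) => //=;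
    rewrite ?andbT ?andbF.
rewrite (_ : [set S]%SET = F (enum 'I_N))//; apply/setP => T; rewrite FE inE.
apply/eqP/andP => [->|[_ /allP TS]]; first by split=> //; apply/allP.
by apply/setP => i; apply/eqP/TS; rewrite mem_enum.
Qed.

Section Additive.
Variables (R : realType) (mu : free_boolean N -> R).
Hypothesis muD : additive_on_class mu.

Lemma additive_sum_atoms f : (0 < N)%N -> finset.set0 \notin f ->
  mu f = \sum_(S in f) mu [set S]%SET.
Proof.
move=> N0 f0.
have C0 : difference_class (finset.set0 : free_boolean N).
  rewrite -(finset.setDv (generator (Ordinal N0))); apply: DDiff; exact: DGen.
have mu0 : mu finset.set0 = 0.
  have := muD C0 C0 (finset.setI0 _); rewrite finset.setU0 => /eqP.
  by rewrite -subr_eq subrr eq_sym => /eqP.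
pose U (s : seq {set 'I_N}) : free_boolean N := [set S | S \in s]%SET.
have US s : uniq s -> finset.set0 \notin s ->
    difference_class (U s) /\ mu (U s) = \sum_(S <- s) mu [set S]%SET.
  elim: s => [_ _|S s IH].
    by rewrite big_nil (_ : U _ = finset.set0)//; apply/setP => S; rewrite !inE.
  rewrite /= in_cons negb_or eq_sym => /andP[Ss us] /andP[S0 s0].
  have [Cs mus] := IH us s0; have CS := difference_class_atom S0.
  have -> : U (S :: s) = ([set S] :|: U s)%SET.
    by apply/setP => T; rewrite !inE.
  split; first exact: DCup.
  rewrite big_cons -mus; apply: muD => //.
  apply/setP => T; rewrite !inE; apply/negbTE; apply: contra Ss.
  by case/andP => /eqP <-.
have [|_] := US (enum f) (enum_uniq _); first by rewrite mem_enum.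
rewrite big_enum/= => <-; congr mu; apply/setP => S.
by rewrite inE mem_enum.
Qed.

End Additive.

Lemma mem_gen_union S J : (S \in gen_union J) = meets S J.
Proof.
apply/bigcupP/set0Pn => [[i iJ]|[i]].
  by rewrite inE => iS; exists i; rewrite inE iS.
by rewrite inE => /andP[iS iJ]; exists i; rewrite ?inE.
Qed.

Lemma union_coefsP (R : realType) f : (0 < N)%N -> finset.set0 \notin f ->
  is_union_coefs R f (union_coef R f).
Proof.
move=> N0 f0; apply: xgetPex.
have [m [m0 mE]] := union_span_mem f0; exists m; split=> // mu muD.
rewrite (additive_sum_atoms muD N0 f0).
have gE J : mu (gen_union J) =
    \sum_(S : {set 'I_N} | S != finset.set0) (meets S J)%:R * mu [set S]%SET.
  rewrite (additive_sum_atoms muD N0); last first.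
    by rewrite mem_gen_union /meets finset.set0I eqxx.
  rewrite big_mkcond [RHS]big_mkcond; apply: eq_bigr => S _.
  rewrite mem_gen_union /meets; have [->|_] := eqVneq S finset.set0.
    by rewrite finset.set0I eqxx.
  by case: (_ != _); rewrite ?mul1r ?mul0r.
under [RHS]eq_bigr do rewrite gE mulr_sumr.
rewrite exchange_big/= big_mkcond [RHS]big_mkcond; apply: eq_bigr => S _.
have [->|S0] := eqVneq S finset.set0; first by rewrite (negbTE f0).
transitivity ((S \in f)%:R%:~R * mu [set S]%SET).
  by case: (S \in f); rewrite ?mul1r ?mul0r.
rewrite mE// rmorph_sum mulr_suml; apply: eq_bigr => J _.
by rewrite rmorphM/= mulrA; congr (_ * _ * _); case: (meets _ _).
Qed.

Lemma dirac_additive (R : realType) S :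
  additive_on_class (fun f : free_boolean N => (S \in f)%:R : R).
Proof.
move=> f g _ _ /setP/(_ S); rewrite !inE.
by case: (S \in f) (S \in g) => [] []// _; rewrite ?addr0 ?add0r.
Qed.

End UnionCoefficients.

(** * Lattice polynomials of real numbers *)

Section Thresholds.
Context {R : realType}.

(** For a value v among the numbers and the preceding value v', the indicator of
   y = v is the difference of those of v' < y and of v < y; a number is then
   recovered as the sum of the v weighted by these indicators. *)
Lemma threshold_sum (I : finType) (P : pred I) (c x : I -> R) (x0 : R) :
  (forall s : R, (s < x0)%R%:R = \sum_(i | P i) c i * (s < x i)%R%:R) ->
  x0 = \sum_(i | P i) c i * x i.
Proof.
move=> h; pose V := undup (x0 :: codom x).
have xV i : x i \in V by rewrite mem_undup in_cons codom_f orbT.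
have x0V : x0 \in V by rewrite mem_undup mem_head.
have uV : uniq V by exact: undup_uniq.
have sumV y : y \in V -> \sum_(v <- V) v * (y == v)%:R = y.
  move=> yV; rewrite (bigD1_seq y)//= eqxx mulr1 big1 ?addr0// => v.
  by rewrite eq_sym => /negbTE ->; rewrite mulr0.
(* compare the thresholds v and its predecessor v' among the values *)
have eqv v : (x0 == v)%:R = \sum_(i | P i) c i * (x i == v)%:R.
  pose v' := \big[Num.max/v - 1]_(y <- V | y < v) y.
  have v'v : v' < v.
    by rewrite /v'; elim/big_ind: _ => [|a b av bv|//]; rewrite ?gtrBl// gt_max av.
  have step y : y \in V -> (y == v)%:R = (v' < y)%R%:R - (v < y)%R%:R :> R.
    move=> yV; have [yv|vy|->] := ltgtP y v.
    - by rewrite ltNge (_ : y <= v') ?subr0// /v'; exact: le_bigmax_seq.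
    - by rewrite (lt_trans v'v vy) subrr.
    - by rewrite v'v subr0.
  rewrite step// h h -sumrB; apply: eq_bigr => i _.
  by rewrite step// mulrBr.
rewrite -[LHS](sumV _ x0V); under eq_bigr do rewrite eqv mulr_sumr.
rewrite exchange_big/=; apply: eq_bigr => i _.
rewrite -[in RHS](sumV _ (xV i)) mulr_sumr; apply: eq_bigr => v _.
by rewrite mulrCA.
Qed.

Variable N : nat.
Implicit Types (a : 'I_N -> R) (J : {set 'I_N}).

(** The iterated maximum starts from a value at an element of J, so that it is right
   also when all the values are negative. *)
Definition max_over J a : R :=
  if [pick i in J] is Some i0 then \big[Num.max/a i0]_(i in J) a i else 0.

Lemma max_over_ge J a i : i \in J -> a i <= max_over J a.
Proof.
move=> iJ; rewrite /max_over; case: pickP => [i0 _|/(_ i)]; last by rewrite iJ.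
exact: le_bigmax_cond.
Qed.

Lemma max_over_attained J a : J != finset.set0 ->
  exists2 i, i \in J & max_over J a = a i.
Proof.
move=> /set0Pn[j jJ]; rewrite /max_over.
case: pickP => [i0 i0J|/(_ j)]; last by rewrite jJ.
elim/big_ind: _ => [|x y [i iJ ->] [k kJ ->]|i iJ]; [by exists i0| |by exists i].
by have [_|_] := leP (a i) (a k); [exists k|exists i].
Qed.

Lemma lt_max_over J a s : J != finset.set0 ->
  (s < max_over J a) = meets [set i | s < a i]%SET J.
Proof.
move=> J0; apply/idP/set0Pn => [sJ|[i]].
  by have [i iJ mE] := max_over_attained a J0; exists i; rewrite !inE -mE sJ.
by rewrite !inE => /andP[si iJ]; exact: lt_le_trans si (max_over_ge a iJ).
Qed.

Lemma lt_lattice_eval (t : lattice_expr N) a s :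
  (s < lattice_eval t a) = ([set i | s < a i]%SET \in lattice_elt t).
Proof.
elim: t => [i|t1 IH1 t2 IH2|t1 IH1 t2 IH2] /=; rewrite !inE//.
  by rewrite lt_max IH1 IH2.
by rewrite lt_min IH1 IH2.
Qed.

Lemma lattice_elt_set0 (t : lattice_expr N) : finset.set0 \notin lattice_elt t.
Proof.
elim: t => [i|t1 IH1 t2 IH2|t1 IH1 t2 IH2] /=; rewrite !inE//.
  by rewrite negb_or IH1.
by rewrite negb_and IH1.
Qed.

(** The coefficients are tested against the Dirac functions at the sets
   {i | s < a_i}, for all the thresholds s. *)
Lemma lattice_evalE (t : lattice_expr N) a : (0 < N)%N ->
  lattice_eval t a = \sum_(J : {set 'I_N} | J != finset.set0)
    (union_coef R (lattice_elt t) J)%:~R * max_over J a.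
Proof.
move=> N0; have [_ mE] := union_coefsP R N0 (lattice_elt_set0 t).
apply: threshold_sum => s; rewrite lt_lattice_eval.
rewrite (mE _ (@dirac_additive N R [set i | s < a i]%SET)).
by apply: eq_bigr => J J0; rewrite mem_gen_union lt_max_over.
Qed.

End Thresholds.

(** * The integral formula *)

Lemma measurable_max_over (R : realType) N disp (X : measurableType disp)
    (a : X -> 'I_N -> R) (J : {set 'I_N}) :
  (forall i, measurable_fun setT (fun x => a x i)) ->
  measurable_fun setT (fun x => max_over J (a x)).
Proof.
move=> ma; rewrite /max_over.
case: (pick (fun i => i \in J)) => [i0|]; last exact: measurable_cst.
elim: (index_enum 'I_N) => [|i s IH].
  by under eq_fun do rewrite big_nil; exact: ma.
under eq_fun do rewrite big_cons.
case: (i \in J); last exact: IH.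
by apply: measurable_maxr; [exact: ma|exact: IH].
Qed.

(* f ranges over L_N, t over all the lattice expressions of f. *)
Theorem theorem3 (R : realType) (N d : nat) (hN : (1 <= N)%N) (hd : (1 <= d)%N)
    (f : free_boolean N) (t : lattice_expr N) (ft : f = lattice_elt t)
    (p : 'I_N -> 'rV[R]_d) :
  ((boolean_intrinsic_volume f 1 p)%:E =
   ((ball_volume R (d - 1))^-1)%:E *
   \int[@surface_measure R d]_(u in @esphere R d)
     (lattice_eval t (fun i => dotp u (p i)))%:E)%E.
Proof.
case: d hd p => // d _ p; rewrite subn1/= ft => {f ft}.
pose h (J : {set 'I_N}) (u : 'rV[R]_d.+1) : R := max_over J (fun i => dotp u (p i)).
pose m (J : {set 'I_N}) : R := (union_coef R (lattice_elt t) J)%:~R.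
have h_ge (J : {set 'I_N}) u i : i \in J -> dotp u (p i) <= h J u.
  exact: (max_over_ge (fun i => dotp u (p i))).
have h_vertex (J : {set 'I_N}) : J != finset.set0 ->
    forall u, exists2 i, i \in J & h J u = dotp u (p i).
  by move=> J0 u; exact: max_over_attained.
have mh J : measurable_fun setT (h J : borel_space R d.+1 -> R).
  apply: measurable_max_over => i; apply: measurable_dotp; last exact: measurable_cst.
  exact: (@measurable_id _ (borel_space R d.+1)).
have hE (J : {set 'I_N}) : J != finset.set0 ->
    (\int[@surface_measure R d.+1]_(u in @esphere R d.+1) (h J u)%:E)%E =
    (ball_volume R d * intrinsic_volume 1 (hull J p))%:E.
  move=> J0; apply: (intrinsic_volume1_support J0 (h_ge J) (h_vertex J J0) (mh J)).
  rewrite /intrinsic_volume; apply: (@xgetPex _ _ [set V | is_intrinsic_volumes (hull J p) V]).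
  exact: steiner_formula.
have [sigma sigmaE] := @surface_measureP R d.+1.
have mS := @measurable_esphere R d.+1.
have -> : (\int[@surface_measure R d.+1]_(u in @esphere R d.+1)
    (lattice_eval t (fun i => dotp u (p i)))%:E =
    \sum_(J : {set 'I_N} | J != finset.set0)
      (m J * (ball_volume R d * intrinsic_volume 1 (hull J p)))%:E)%E.
  rewrite -sigmaE.
  transitivity (\int[sigma]_(u in @esphere R d.+1)
    \sum_(J : {set 'I_N} | J != finset.set0) ((m J)%:E * (h J u)%:E))%E.
    apply: eq_integral => u _; rewrite lattice_evalE// -sumEFin.
    by apply: eq_bigr => J _; rewrite EFinM.
  have ih (J : {set 'I_N}) : sigma.-integrable (@esphere R d.+1) (EFin \o h J).
    have [->|J0] := eqVneq J finset.set0; last first.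
      exact: (integrable_sphere sigmaE (mh J) (support_norm_le (h_vertex J J0))).
    apply: (integrable_sphere (C := 0) sigmaE (mh _)) => u _.
    rewrite /h /max_over; case: pickP => [i|_]; last by rewrite normr0.
    by rewrite inE.
  rewrite (integral_sum mS (fun J => integrableZl mS (m J) (ih J))).
  apply: eq_bigr => J J0; rewrite (integralZl mS (ih J)) sigmaE hE//.
rewrite sumEFin -EFinM mulr_sumr; congr EFin; apply: eq_bigr => J _.
by rewrite mulrCA mulKf// gt_eqF// ball_volume_gt0.
Qed.
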